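(* Let $r \in (0,1)$ and $\delta \in (0,\tfrac12)$ satisfy $r < 1 - h(\delta)$. There are constants $N$ and $K$, depending only on $r$ and $\delta$, such that for every integer $n \ge N$ and every integer $d \ge 3$ (not necessarily a constant) there exists a linear circuit $C:\{0,1\}^n \to \{0,1\}^{\lfloor n/r \rfloor}$ of depth $d$ and size at most $K\,\lambda_d(n)\, n$ that encodes an error-correcting code with relative distance at least $\delta$, i.e. $\mathrm{dist}(C(x),C(y)) \ge \delta \lfloor n/r\rfloor$ for all distinct $x,y\in\{0,1\}^n$. In particular, taking $d=\alpha(n)$, the circuit has size $O_{r,\delta}(n)$.
   Context: $h$ is the binary entropy function and $\mathrm{dist}$ is Hamming distance. A linear circuit is a directed acyclic graph whose source vertices are the input variables $x_1,\dots,x_n$ over $\mathrm{GF}(2)$ and whose every other vertex (gate) computes the XOR (sum mod 2) of the values of its in-neighbours; fan-in and fan-out are unbounded; certain gates are designated (in order) as outputs, and the circuit computes the map given by the output values. Size is the number of wires (edges); depth is the maximum number of edges on a path from an input to an output. For $f:\mathbb{N}\to\mathbb{N}$ let $f^{(i)}$ be its $i$-fold composition and $f^*(n)=\min\{i: f^{(i)}(n)\le 1\}$. Define $\lambda_1(n)=\lfloor\sqrt n\rfloor$, $\lambda_2(n)=\lceil \log_2 n\rceil$, and $\lambda_d(n)=\lambda_{d-2}^*(n)$ for $d\ge 3$. Define $\alpha(n)=\min\{\text{even } d : \lambda_d(n)\le 6\}$. *)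

(* Defs.v *)
From HB Require Import structures.
From Stdlib Require PeanoNat.
From mathcomp Require Import all_boot all_order all_algebra.
From mathcomp Require Import boolp reals exp.

Set Implicit Arguments.
Unset Strict Implicit.
Unset Printing Implicit Defensive.

Import Order.TTheory GRing.Theory Num.Theory.

Local Open Scope nat_scope.

(* The junk value 0 is never used below: see lambda_iter and alphaP. *)
Definition min_nat (P : pred nat) : nat :=
  if pselect (exists i, P i) is left exP then ex_minn exP else 0.

Definition star (f : nat -> nat) (n : nat) : nat :=
  min_nat (fun i => iter i f n <= 1).

(* lambda 0 is a dummy; up_log 2 n is the least e such that n <= 2 ^ e. *)
Fixpoint lambda (d : nat) : nat -> nat :=
  match d with
  | 0 => id
  | 1 => Nat.sqrt
  | 2 => up_log 2
  | (_.+1 as e).+2 => star (lambda e)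
  end.

(* lambda d is only meaningful for d > 0, so the minimum is over d = 2, 4, ... *)
Definition alpha (n : nat) : nat :=
  min_nat (fun d => [&& 0 < d, ~~ odd d & lambda d n <= 6]).

Lemma min_natP (P : pred nat) :
  (exists i, P i) -> P (min_nat P) /\ (forall i, P i -> min_nat P <= i).
Proof.
by rewrite /min_nat => exP; case: pselect => // exP'; case: ex_minnP.
Qed.

Lemma iter_le1 (f : nat -> nat) n :
  (forall m, 1 < m -> f m < m) -> exists2 i, i <= n.-1 & iter i f n <= 1.
Proof.
move=> f_lt; elim/ltn_ind: n => n IHn.
have [n_le1|n_gt1] := leqP n 1; first by exists 0.
have [i le_i le1] := IHn _ (f_lt _ n_gt1).
exists i.+1; last by rewrite iterSr.
have := f_lt _ n_gt1; case: (f n) le_i => [|k] /= le_i lt_n.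
  by move: le_i; rewrite leqn0 => /eqP->; case: (n) n_gt1 => [|[]].
by rewrite -ltnS prednK ?(ltnW n_gt1)// (leq_trans _ lt_n).
Qed.

Lemma star_le_pred (f : nat -> nat) n :
  (forall m, 1 < m -> f m < m) -> star f n <= n.-1.
Proof.
move=> f_lt; have [i le_i le1] := @iter_le1 f n f_lt.
apply: leq_trans le_i; apply: (proj2 (min_natP _)) => //.
by exists i.
Qed.

Lemma lambda_star d : 0 < d -> lambda d.+2 = star (lambda d).
Proof. by case: d. Qed.

Lemma lambda_lt d n : 0 < d -> 1 < n -> lambda d n < n.
Proof.
elim/ltn_ind: d n => -[|[|[|d]]] // IHd n _ n_gt1.
- by apply/ssrnat.ltP; apply: PeanoNat.Nat.sqrt_lt_lin; apply/ssrnat.ltP.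
- case: n n_gt1 => // n _; apply: up_log_min => //.
  by elim: n => // n IHn; rewrite expnS mul2n -addnn -addn1 leq_add ?expn_gt0.
rewrite lambda_star //.
apply: leq_ltn_trans (star_le_pred n _) _ => [m|]; first exact: IHd.
by rewrite prednK ?(ltnW n_gt1).
Qed.

Lemma lambda_iter d n : 0 < d -> exists i, iter i (lambda d) n <= 1.
Proof.
move=> d_gt0; have [m|i _ le1] := @iter_le1 (lambda d) n.
  exact: lambda_lt.
by exists i.
Qed.

Lemma starS d n :
  0 < d -> lambda d.+2 n <= (lambda d.+2 (lambda d n)).+1.
Proof.
move=> d_gt0; rewrite lambda_star //.
apply: (proj2 (min_natP (lambda_iter n d_gt0))).
rewrite iterSr; exact: (proj1 (min_natP (lambda_iter (lambda d n) d_gt0))).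
Qed.

Lemma lambda_even_lt d n : 0 < d -> ~~ odd d -> 6 < n -> (lambda d n).+1 < n.
Proof.
elim/ltn_ind: d n => -[|[|[|d]]] // IHd n _ d_even n_gt6.
  case: n n_gt6 => [|[|n]] // n_gt6; rewrite !ltnS; apply: up_log_min => //.
  move: n_gt6; rewrite !ltnS; elim: n => // n IHn.
  rewrite leq_eqVlt => /predU1P[<- //|/IHn le_n].
  by rewrite expnS mul2n -addnn -addn1 leq_add ?expn_gt0.
rewrite negbK -/(~~ odd d) in d_even *.
have lt_n : (lambda d.+1 n).+1 < n by apply: IHd.
have := starS n (ltn0Sn d); rewrite [in X in _ <= X.+1]lambda_star //.
have := @star_le_pred (lambda d.+1) (lambda d.+1 n) (fun m => @lambda_lt d.+1 m isT).
case: (lambda d.+1 n) lt_n => [|k] lt_n /= le_pred le_S.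
  apply: leq_trans n_gt6; rewrite !ltnS; apply: leq_trans le_S _.
  by rewrite ltnS (leq_trans le_pred).
by apply: leq_ltn_trans lt_n; rewrite ltnS (leq_trans le_S).
Qed.

Lemma alphaP n :
  [/\ 0 < alpha n, ~~ odd (alpha n), lambda (alpha n) n <= 6
    & forall d, 0 < d -> ~~ odd d -> lambda d n <= 6 -> alpha n <= d].
Proof.
have exd k : forall d, 0 < d -> ~~ odd d -> lambda d n <= k ->
    exists d, [&& 0 < d, ~~ odd d & lambda d n <= 6].
  elim: k => [|k IHk] d d_gt0 d_even le_k.
    by exists d; rewrite d_gt0 d_even (leq_trans le_k).
  have [le6|gt6] := leqP (lambda d n) 6; first by exists d; rewrite d_gt0 d_even.
  apply: (IHk d.+2) => //=; first by rewrite negbK.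
  rewrite -ltnS; apply: leq_trans le_k.
  apply: leq_ltn_trans (starS n d_gt0) _.
  by apply: lambda_even_lt => //=; rewrite negbK.
have [/and3P[gt0 even le6] min] :=
  min_natP (exd (lambda 2 n) 2 isT isT (leqnn _)).
by split=> // d d_gt0 d_even le6d; apply: min; rewrite d_gt0 d_even.
Qed.

Record lin_circuit (n m : nat) := LinCircuit {
  vertex : finType;
  wire : rel vertex;
  input : 'I_n -> vertex;
  output : 'I_m -> vertex;
  wire_acyclic : forall v p, ~~ cycle wire (v :: p);
  input_inj : injective input;
  inputP : forall v, (v \in codom input) = [forall u, ~~ wire u v];
  output_inj : injective output;
  output_gate : forall j, output j \notin codom input
}.

Section Circuits.
Variables n m : nat.
Implicit Type C : lin_circuit n m.

(* The fuel #|vertex C| used in value is sufficient because C is acyclic: see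
   value_input and value_gate. *)
Fixpoint value_rec C (x : 'rV['F_2]_n) (k : nat) (v : vertex C) : 'F_2 :=
  if k is k'.+1 then
    if [pick i | input C i == v] is Some i then x ord0 i
    else (\sum_(u | wire u v) value_rec x k' u)%R
  else 0%R.

Definition value C (x : 'rV['F_2]_n) (v : vertex C) : 'F_2 :=
  value_rec x #|vertex C| v.

Definition compute C (x : 'rV['F_2]_n) : 'rV['F_2]_m :=
  \row_j value x (output C j).

Definition circuit_size C : nat := #|[set e : vertex C * vertex C | wire e.1 e.2]|.

Definition is_io_path C i (p : seq (vertex C)) : bool :=
  path (@wire _ _ C) (input C i) p && (last (input C i) p \in codom (output C)).

(* Paths of an acyclic graph have fewer than #|vertex C| edges, so nothing is lost
   by bounding their length: see circuit_depth_leP. *)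
Definition circuit_depth C : nat :=
  \max_(i < n) \max_(k < #|vertex C| | [exists p : k.-tuple (vertex C),
    is_io_path i p]) k.

Lemma value_input C x i : value x (input C i) = x ord0 i.
Proof.
rewrite /value; have : 0 < #|vertex C| by apply/card_gt0P; exists (input C i).
case: #|_| => //= k _; case: pickP => [j /eqP/input_inj-> //|/(_ i)].
by rewrite eqxx.
Qed.

Lemma value_gate C x (v : vertex C) :
  v \notin codom (input C) -> value x v = (\sum_(u | wire u v) value x u)%R.
Proof.
move=> v_gate.
pose anc (w : vertex C) := #|[pred u | connect (@wire _ _ C) u w]|.
have anc_lt u w : wire u w -> anc u < anc w.
  move=> uw; apply/proper_card/properP; split.
    by apply/subsetP=> t; rewrite !inE => /connect_trans; apply; apply: connect1.
  exists w; rewrite !inE ?connect0 //; apply/negP=> /connectP[p wp def_u].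
  have /negP[] := wire_acyclic w p.
  by rewrite /= rcons_path wp -def_u.
have stable k l w : anc w <= k -> anc w <= l ->
    value_rec x k w = value_rec x l w.
  have anc_gt0 t : 0 < anc t by apply/card_gt0P; exists t; rewrite inE connect0.
  elim: k l w => [|k IHk] [|l] w; try by rewrite leqNgt anc_gt0.
    by move=> _; rewrite leqNgt anc_gt0.
  move=> lek lel /=; case: pickP => // _.
  apply: eq_bigr => u /anc_lt lt_u.
  by apply: IHk; rewrite -ltnS (leq_trans lt_u).
rewrite /value; have le_anc w : anc w <= #|vertex C| by apply: max_card.
rewrite (stable _ #|vertex C|.+1 v) ?leqW //=.
case: pickP => // i /eqP def_v; by rewrite -def_v codom_f in v_gate.
Qed.

Lemma circuit_depth_leP C d :
  reflect (forall i (p : seq (vertex C)), is_io_path i p -> size p <= d)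
          (circuit_depth C <= d).
Proof.
apply: (iffP (bigop.bigmax_leqP _ _ _)) => [le_d i p io|le_d i _].
  have p_lt : size p < #|vertex C|.
    suff /card_uniqP : uniq (input C i :: p).
      by move=> /= <-; apply: max_card.
    have /andP[ip _] := io; move: (input C i) ip => v.
    elim: p {io} v => //= w p IHp v /andP[vw wp]; rewrite IHp // andbT.
    apply/negP=> v_in; have vwp : path (@wire _ _ C) v (w :: p) by rewrite /= vw.
    case/splitPr: v_in vwp => p1 p2; rewrite -cat_rcons cat_path => /andP[cyc _].
    by have /negP := wire_acyclic v p1; apply.
  have /bigop.bigmax_leqP/(_ (Ordinal p_lt)) := le_d i isT; apply.
  by apply/existsP; exists (in_tuple p).
apply/bigop.bigmax_leqP=> k /existsP[p io]; rewrite -(size_tuple p).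
exact: le_d io.
Qed.

End Circuits.

Definition hdist (m : nat) (u v : 'rV['F_2]_m) : nat :=
  #|[set j | u ord0 j != v ord0 j]|.

Local Open Scope ring_scope.

Definition log2 (R : realType) (x : R) : R := ln x / ln 2.

Definition entropy (R : realType) (p : R) : R :=
  - p * log2 p - (1 - p) * log2 (1 - p).

Definition rel_dist_ge (R : realType) (delta : R) (n m : nat)
    (f : 'rV['F_2]_n -> 'rV['F_2]_m) : Prop :=
  forall x y, x != y -> delta * m%:R <= (hdist (f x) (f y))%:R.

(* Main.v *)
(* Sample the columns of the last layer independently, each as the XOR of a few
   random bits of an intermediate vector.  If that vector has density bounded
   below, each output bit is nearly unbiased, and a union bound over all messages
   and all supports of small weight reaches the Gilbert-Varshamov bound.  It is
   thus enough to supply, for every nonzero message, one dense vector among a few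
   blocks, one block per range of relative weights.

   The block for weights between n / r and n / q^3 first condenses the n inputs to
   about n / q^2 bits by O(n) wires without decreasing the weight (a random
   bipartite graph of constant left degree has many unique neighbours), and then
   uses a code of depth d on these bits.  If such codes cost K (f r + 1)^2 wires
   per input, the choice q = a (f r + 1) makes the inner code cost 2 K / a^2 wires
   per input, so that for a large constant a the constant K does not grow with the
   depth.  Two blocks replace r by f r, hence O(f^* r + 1) blocks suffice and
   f = lambda_d becomes f^* = lambda_(d+2) at the price of two more layers.  The
   recursion starts from depth 2 with cost (log r)^2, and from depth 1 with cost r,
   where q is about r^(1/4) and three blocks replace r by its square root. *)

Require Import Defs.
From mathcomp Require Import all_boot all_order all_algebra.
From mathcomp Require Import zify ring lra.
From mathcomp Require Import reals sequences exp.

Set Implicit Arguments.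
Unset Strict Implicit.
Unset Printing Implicit Defensive.

Import Order.TTheory GRing.Theory Num.Theory.

Local Open Scope ring_scope.

(** * Circuits as block matrices *)

Definition nnz m n (A : 'M['F_2]_(m, n)) : nat :=
  (\sum_i \sum_j (A i j != 0%R))%N.

Definition wt n (x : 'rV['F_2]_n) : nat := (\sum_j (x ord0 j != 0%R))%N.

Lemma nnz0 m n : nnz (0 : 'M['F_2]_(m, n)) = 0%N.
Proof.
by rewrite /nnz big1 // => i _; rewrite big1 // => j _; rewrite mxE eqxx.
Qed.

Lemma nnz_row_mx m n1 n2 (A : 'M['F_2]_(m, n1)) (B : 'M_(m, n2)) :
  nnz (row_mx A B) = (nnz A + nnz B)%N.
Proof.
rewrite /nnz -big_split /=; apply: eq_bigr => i _.
rewrite big_split_ord /=; congr (_ + _)%N; apply: eq_bigr => j _.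
  by rewrite row_mxEl.
by rewrite row_mxEr.
Qed.

Lemma nnz_col_mx m1 m2 n (A : 'M['F_2]_(m1, n)) (B : 'M_(m2, n)) :
  nnz (col_mx A B) = (nnz A + nnz B)%N.
Proof.
rewrite /nnz big_split_ord /=; congr (_ + _)%N; apply: eq_bigr => i _;
  apply: eq_bigr => j _.
  by rewrite col_mxEu.
by rewrite col_mxEd.
Qed.

(* W and U are the wires into the g inner gates from the inputs and from inner
   gates, P and Q those into the outputs.  Y holds the linear forms computed by the
   inner gates, lev is a topological order, and gates and outputs count in the size
   along with the wires.  Unlike in lin_circuit, a gate may have no wire. *)
Definition circ n m (d s : nat) (M : 'M['F_2]_(n, m)) : Prop :=
  exists g (W : 'M['F_2]_(n, g)) (U : 'M['F_2]_g) (Y : 'M['F_2]_(n, g))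
    (P : 'M['F_2]_(n, m)) (Q : 'M['F_2]_(g, m)) (lev : 'I_g -> nat),
  [/\ Y = W + Y *m U /\ M = P + Y *m Q,
      forall i j, U i j != 0 -> (lev i < lev j)%N,
      forall i, (0 < lev i < d)%N, (0 < d)%N
    & (nnz W + nnz U + nnz P + nnz Q + g + m <= s)%N].

Lemma circ_mono n m d s d' s' (M : 'M['F_2]_(n, m)) :
  (d <= d')%N -> (s <= s')%N -> circ d s M -> circ d' s' M.
Proof.
move=> led les [g [W [U [Y [P [Q [lev [eqs levU lev_d d_gt0 size_s]]]]]]]].
exists g, W, U, Y, P, Q, lev; split=> //.
- by move=> i; have := lev_d i; lia.
- by lia.
- by lia.
Qed.

Lemma circ_layer n m (A : 'M['F_2]_(n, m)) : circ 1 (nnz A + m) A.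
Proof.
exists 0%N, 0, 0, 0, A, 0, (fun=> 0%N); split=> //.
- by rewrite !mul0mx !addr0.
- by case.
- by case.
- by rewrite !nnz0; lia.
Qed.

(** The outputs of the first circuit become inner gates on level [d1], and the levels of the second
    are shifted by [d1]. These gates are already paid for, since sizes count outputs. *)
Lemma circ_comp n m p d1 s1 d2 s2 (M1 : 'M['F_2]_(n, m)) (M2 : 'M['F_2]_(m, p)) :
  circ d1 s1 M1 -> circ d2 s2 M2 -> circ (d1 + d2) (s1 + s2) (M1 *m M2).
Proof.
move=> [g1 [W1 [U1 [Y1 [P1 [Q1 [lev1 [[eqY1 eqM1] levU1 lev_d1 d1_gt0 size1]]]]]]]].
move=> [g2 [W2 [U2 [Y2 [P2 [Q2 [lev2 [[eqY2 eqM2] levU2 lev_d2 d2_gt0 size2]]]]]]]].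
exists (g1 + m + g2)%N, (row_mx (row_mx W1 P1) 0),
  (block_mx (block_mx U1 Q1 0 0) (col_mx 0 W2) 0 U2),
  (row_mx (row_mx Y1 M1) (M1 *m Y2)), 0, (col_mx (col_mx 0 P2) Q2),
  (fun i => match split i with
   | inl j => match split j with inl k => lev1 k | inr _ => d1 end
   | inr k => (d1 + lev2 k)%N end).
split.
- split.
    rewrite mul_row_block mul_row_block mul_row_col !mulmx0 !addr0 add0r.
    rewrite !add_row_mx -eqY1 -eqM1 add0r -mulmxA -mulmxDr -eqY2 //.
  rewrite !mul_row_col mulmx0 !add0r eqM2 mulmxDr mulmxA //.
- move=> i j; case: (split_ordP i) => i' ->; case: (split_ordP j) => j' ->.
  + rewrite block_mxEul.
    case: (split_ordP i') => i'' ->; case: (split_ordP j') => j'' ->.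
    * by rewrite block_mxEul; apply: levU1.
    * by rewrite block_mxEur; case/andP: (lev_d1 i'').
    * by rewrite block_mxEdl mxE eqxx.
    * by rewrite block_mxEdr mxE eqxx.
  + rewrite block_mxEur; have := lev_d2 j'.
    case: (split_ordP i') => i'' ->; first by rewrite col_mxEu mxE eqxx.
    by lia.
  + by rewrite block_mxEdl mxE eqxx.
  + by rewrite block_mxEdr => /levU2; lia.
- move=> i; case: (split_ordP i) => i' _; last by have := lev_d2 i'; lia.
  case: (split_ordP i') => i'' _; last lia.
  by have := lev_d1 i''; lia.
- by lia.
rewrite /block_mx !(nnz_row_mx, nnz_col_mx, nnz0); lia.
Qed.

Lemma circ_join n m1 m2 d s1 s2 (M1 : 'M['F_2]_(n, m1)) (M2 : 'M['F_2]_(n, m2)) :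
  circ d s1 M1 -> circ d s2 M2 -> circ d (s1 + s2) (row_mx M1 M2).
Proof.
move=> [g1 [W1 [U1 [Y1 [P1 [Q1 [lev1 [[eqY1 eqM1] levU1 lev_d1 d1_gt0 size1]]]]]]]].
move=> [g2 [W2 [U2 [Y2 [P2 [Q2 [lev2 [[eqY2 eqM2] levU2 lev_d2 d2_gt0 size2]]]]]]]].
exists (g1 + g2)%N, (row_mx W1 W2), (block_mx U1 0 0 U2), (row_mx Y1 Y2),
  (row_mx P1 P2), (block_mx Q1 0 0 Q2),
  (fun i => match split i with inl j => lev1 j | inr k => lev2 k end).
split=> //.
- rewrite !mul_row_block !mulmx0 !addr0 !add0r !add_row_mx.
  by rewrite -eqY1 -eqY2 -eqM1 -eqM2.
- move=> i j; case: (split_ordP i) => i' ->; case: (split_ordP j) => j' ->.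
  + by rewrite block_mxEul; apply: levU1.
  + by rewrite block_mxEur mxE eqxx.
  + by rewrite block_mxEdl mxE eqxx.
  + by rewrite block_mxEdr; apply: levU2.
- move=> i; case: (split_ordP i) => i' _; [exact: lev_d1|exact: lev_d2].
rewrite /block_mx !(nnz_row_mx, nnz_col_mx, nnz0); lia.
Qed.

(** * From block matrices to linear circuits *)

Lemma F2P (a : 'F_2) : a = 0 \/ a = 1.
Proof. by case: a => -[|[|//]] ?; [left|right]; apply/val_inj. Qed.

Lemma F2_neq0 (a : 'F_2) : a != 0 -> a = 1.
Proof. by case: (F2P a) => ->; rewrite ?eqxx. Qed.

(* In lin_circuit every gate needs a wire.  Gates computing the zero form are cut
   off and fed by the first input instead; this only changes outputs that vanish on
   all messages, so no distance decreases. *)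
Lemma net_lin_circuit n m g d s (W : 'M['F_2]_(n, g)) (U : 'M_g) (Y : 'M_(n, g))
    (lev : 'I_g -> nat) (out : 'I_m -> 'I_g) :
  (0 < n)%N -> Y = W + Y *m U -> (forall k l, U k l != 0 -> (lev k < lev l)%N) ->
  (forall k, 0 < lev k <= d)%N -> injective out -> (nnz W + nnz U + g <= s)%N ->
  exists C : lin_circuit n m,
    [/\ (circuit_depth C <= d)%N, (circuit_size C <= s)%N
      & forall x y, (hdist (x *m colsub out Y) (y *m colsub out Y)
                     <= hdist (compute C x) (compute C y))%N].
Proof.
move=> n_gt0 eqY levU lev_d out_inj size_s.
pose i0 : 'I_n := Ordinal n_gt0.
pose live k := col k Y != 0.
pose V := ('I_n + 'I_g)%type.
pose wr : rel V := fun u v => match u, v with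
  | inl i, inr k => if live k then W i k != 0 else i == i0
  | inr l, inr k => [&& live k, live l & U l k != 0]
  | _, _ => false end.
pose L (v : V) := match v with inl _ => 0%N | inr k => lev k end.
have wrL u v : wr u v -> (L u < L v)%N.
  case: u v => [i|l] [j|k] //=; first by have /andP[] := lev_d k.
  by case/and3P=> _ _ /levU.
have pathL u p : path wr u p -> (L u + size p <= L (last u p))%N.
  elim: p u => [|v p IH] u /=; first by rewrite addn0.
  by case/andP=> /wrL uv /IH; lia.
have acyc v p : ~~ cycle wr (v :: p).
  by apply/negP=> /= /pathL; rewrite last_rcons size_rcons; lia.
have in_inj : injective (inl : 'I_n -> V) by move=> i j [].
have codomE v : (v \in codom (inl : 'I_n -> V)) = [forall u, ~~ wr u v].
  apply/codomP/forallP=> [[i ->] [] //|no_in].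
  case: v no_in => [i|k] no_in; first by exists i.
  (* A dead gate has its wire from [i0]; a live gate without wires would have a zero column in
     [Y = W + Y *m U]. *)
  exfalso; have [lk|dead] := boolP (live k); last first.
    by have := no_in (inl i0); rewrite /wr (negbTE dead) eqxx.
  case/negP: (lk); apply/eqP/colP=> i; rewrite mxE [RHS]mxE eqY mxE [X in _ + X]mxE.
  have /negP := no_in (inl i); rewrite /wr lk => /negP; rewrite negbK => /eqP->.
  rewrite add0r big1 // => l _; have := no_in (inr l); rewrite /wr lk /=.
  rewrite negb_and !negbK => /orP[|/eqP->]; last by rewrite mulr0.
  by move=> /eqP/colP/(_ i); rewrite !mxE => ->; rewrite mul0r.
have out_inj' : injective (fun j => inr (out j) : V) by move=> i j [/out_inj].
have out_gate (j : 'I_m) : (inr (out j) : V) \notin codom (inl : 'I_n -> V).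
  by apply/codomP=> -[].
pose C := LinCircuit acyc in_inj codomE out_inj' out_gate.
have gateN k : (inr k : V) \notin codom (input C) by apply/codomP=> -[].
have valE x k : live k -> value x (inr k : vertex C) = (x *m Y) ord0 k.
  have [N] := ubnP (lev k); elim: N k => // N IH k ltN lk.
  rewrite value_gate // [LHS]big_sumType /= eqY mulmxDr mulmxA.
  rewrite [RHS]mxE [X in _ = X + _]mxE [X in _ = _ + X]mxE lk; congr (_ + _).
    rewrite big_mkcond; apply: eq_bigr => i _.
    rewrite (@value_input _ _ C).
    by case: (F2P (W i k)) => ->; rewrite ?eqxx ?mulr0 ?mulr1 //= oner_eq0.
  rewrite big_mkcond; apply: eq_bigr => l _.
  have [ll /=|/= ] := boolP (live l); last first.
    rewrite negbK => /eqP dead; suff -> : (x *m Y) ord0 l = 0 by rewrite mul0r.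
    rewrite mxE big1 // => i _.
    by move/colP/(_ i): dead; rewrite !mxE => ->; rewrite mulr0.
  have [->|Ulk] := eqVneq (U l k) 0; first by rewrite mulr0.
  rewrite (F2_neq0 Ulk) mulr1; have lt_l := levU l k Ulk.
  by apply: IH => //; lia.
exists C; split.
- apply/circuit_depth_leP=> i p /andP[/pathL /= + _].
  rewrite add0n => /leq_trans; apply.
  by case: (last _ _) => //= k; case/andP: (lev_d k).
- rewrite /circuit_size -sum1_card.
  have -> : (\sum_(i in [set e : vertex C * vertex C | wire e.1 e.2]) 1 =
     \sum_u \sum_v (wr u v : nat))%N.
    rewrite pair_big /= big_mkcond; apply: eq_bigr => -[u v] _.
    by rewrite inE /=; case: (wr u v).
  rewrite [X in (X <= _)%N]big_sumType /=.
  rewrite (eq_bigr (fun i => \sum_(k < g) wr (inl i) (inr k))%N); last first.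
    by move=> i _; rewrite big_sumType /= big1 // add0n.
  rewrite [X in (_ + X <= _)%N](eq_bigr (fun l => \sum_(k < g) wr (inr l) (inr k))%N); last first.
    by move=> i _; rewrite big_sumType /= big1 // add0n.
  (* Each dead gate has a single wire, paid for by the summand [g] of the size. *)
  have le1 : (\sum_i \sum_(k < g) wr (inl i) (inr k) <=
      nnz W + \sum_(k < g) 1)%N.
    rewrite /nnz exchange_big [X in (_ <= X + _)%N]exchange_big -big_split /=.
    apply: leq_sum => k _; case: (live k); first by rewrite leq_addr.
    rewrite -[X in (X <= _)%N]big_mkcond (big_pred1 i0) //; lia.
  have le2 : (\sum_l \sum_(k < g) wr (inr l) (inr k) <= nnz U)%N.
    apply: leq_sum => l _; apply: leq_sum => k _ /=.
    by case: (live k); case: (live l).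
  apply: leq_trans (leq_add le1 le2) _; rewrite sum1_card card_ord; lia.
move=> x y; apply/subset_leq_card/subsetP=> j; rewrite !inE => xyj.
have outE z : (z *m colsub out Y) ord0 j = (z *m Y) ord0 (out j).
  by rewrite !mxE; apply: eq_bigr => i _; rewrite mxE.
rewrite !outE in xyj; rewrite !mxE /= !valE //.
all: apply/negP=> /eqP/colP dead; case/eqP: xyj; rewrite !mxE.
all: rewrite !big1 // => i _; have := dead i; rewrite !mxE => ->; rewrite mulr0 //.
Qed.

Lemma circ_lin_circuit n m d s (M : 'M['F_2]_(n, m)) : (0 < n)%N -> circ d s M ->
  exists C : lin_circuit n m,
    [/\ (circuit_depth C <= d)%N, (circuit_size C <= s)%N
      & forall x y, (hdist (x *m M) (y *m M) <= hdist (compute C x) (compute C y))%N].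
Proof.
move=> n_gt0 [g [W [U [Y [P [Q [lev [[eqY eqM] levU lev_d d_gt0 size_s]]]]]]]].
(* The outputs become gates of level [d], above all inner gates. *)
have -> : M = colsub (@rshift g m) (row_mx Y M).
  by apply/matrixP=> i j; rewrite mxE row_mxEr.
apply: (@net_lin_circuit n m (g + m)%N d s (row_mx W P) (block_mx U Q 0 0)
  (row_mx Y M) (fun k => match split k with inl j => lev j | inr _ => d end)) => //.
- by rewrite mul_row_block !mulmx0 !addr0 add_row_mx -eqY -eqM.
- move=> k l; case: (split_ordP k) => k' ->; case: (split_ordP l) => l' ->.
  + by rewrite block_mxEul; apply: levU.
  + by rewrite block_mxEur; case/andP: (lev_d k').
  + by rewrite block_mxEdl mxE eqxx.
  + by rewrite block_mxEdr mxE eqxx.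
- move=> k; case: (split_ordP k) => k' _; last by rewrite d_gt0 /=.
  by have := lev_d k'; lia.
- exact: rshift_inj.
- by rewrite /block_mx !(nnz_row_mx, nnz_col_mx, nnz0); lia.
Qed.

(** * Random columns *)

Lemma union_bound (T I : finType) (P : pred I) (B : I -> {set T}) :
  (\sum_(i | P i) #|B i| < #|T|)%N -> exists a, forall i, P i -> a \notin B i.
Proof.
move=> lt_T; pose U := \bigcup_(i | P i) B i.
have leU : (#|U| <= \sum_(i | P i) #|B i|)%N.
  rewrite /U; elim/big_rec2: _ => [|i s S _ le_s]; first by rewrite cards0.
  by apply: leq_trans (leq_card_setU _ _) _; rewrite leq_add2l.
have /set0Pn[a] : ~: U != set0.
  by rewrite -card_gt0 cardsCs setCK subn_gt0; apply: leq_ltn_trans lt_T.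
rewrite inE => aU; exists a => i Pi; apply: contra aU => aB.
by apply/bigcupP; exists i.
Qed.

Lemma card_family_prod (aT rT : finType) (F : aT -> pred rT) :
  #|family F| = (\prod_j #|F j|)%N.
Proof. by rewrite card_family foldrE big_map big_enum. Qed.

(** Union bound over [x] and the set [J] of columns with value 1: for independent columns a fixed
    pair has probability at most [((1 + 2 ^- t) / 2) ^ m]. *)
Lemma exists_columns (T Om : finType) (X : {set T}) (f : T -> Om -> bool) (t m k : nat) :
  (0 < #|Om|)%N ->
  (forall x b, x \in X -> 2 ^ t.+1 * #|[set o | f x o == b]| <= (2 ^ t).+1 * #|Om|)%N ->
  (#|X| * #|[set J : {set 'I_m} | #|J| < k]| * (2 ^ t).+1 ^ m < 2 ^ (t.+1 * m))%N ->
  exists phi : 'I_m -> Om, forall x, x \in X -> (k <= #|[set j | f x (phi j)]|)%N.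
Proof.
move=> Om_gt0 f_bias lt_X.
pose B (p : T * {set 'I_m}) := [set phi : {ffun 'I_m -> Om} |
  [set j | f p.1 (phi j)] == p.2].
pose P (p : T * {set 'I_m}) := (p.1 \in X) && (p.2 \in [set J : {set 'I_m} | #|J| < k]%N).
have cardB p : P p -> (2 ^ (t.+1 * m) * #|B p| <= ((2 ^ t).+1 * #|Om|) ^ m)%N.
  case: p => x J /andP[/= xX _].
  have -> : #|B (x, J)| = (\prod_(j < m) #|[set o | f x o == (j \in J)]|)%N.
    transitivity #|family (fun j : 'I_m => mem [set o | f x o == (j \in J)])|.
      apply: eq_card => phi; rewrite inE /=.

      apply/eqP/familyP => [<- j|phiJ]; first by rewrite !inE.
      by apply/setP=> j; have := phiJ j; rewrite !inE => /eqP.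
    by rewrite card_family_prod.
  have cst c : (c ^ m = \prod_(j < m) c)%N by rewrite prod_nat_const card_ord.
  by rewrite expnM !cst -big_split /=; apply: leq_prod => j _; apply: f_bias.
have [|phi phiP] := @union_bound {ffun 'I_m -> Om} _ P B.
  rewrite card_ffun card_ord.
  have : (2 ^ (t.+1 * m) * \sum_(p | P p) #|B p| < 2 ^ (t.+1 * m) * #|Om| ^ m)%N.
    rewrite big_distrr /=.
    apply: (@leq_ltn_trans (\sum_(p | P p) ((2 ^ t).+1 * #|Om|) ^ m)).
      exact: leq_sum.
    rewrite sum_nat_const.
    have -> : #|P| = (#|X| * #|[set J : {set 'I_m} | #|J| < k]%N|)%N.
      rewrite -cardsX; apply: eq_card => -[x J]; rewrite [RHS]inE /=; exact: erefl.
    rewrite expnMn mulnA ltn_pmul2r // expn_gt0 Om_gt0 //.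
  by rewrite ltn_pmul2l // expn_gt0.
exists phi => x xX; rewrite leqNgt; apply/negP=> lt_k.
have := phiP (x, [set j | f x (phi j)]); rewrite /P /= xX !inE eqxx => /(_ lt_k).
by [].
Qed.

(** * The bias of random linear forms *)

Definition sg (a : 'F_2) : int := (-1) ^+ (a != 0).

Lemma sgD a b : sg (a + b) = sg a * sg b.
Proof. by rewrite /sg; case: (F2P a) (F2P b) => -> [] ->. Qed.

Lemma sg_sum I (s : seq I) (F : I -> 'F_2) :
  sg (\sum_(i <- s) F i) = \prod_(i <- s) sg (F i).
Proof. by elim/big_rec2: _ => [//|i x y _ <-]; rewrite sgD. Qed.

(** The expected sign of a random linear form of [y], times [#|Om|] to stay in the integers. *)
Definition bias L (Om : finType) (g : Om -> 'cV['F_2]_L) (y : 'rV['F_2]_L) : int :=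
  \sum_o sg ((y *m g o) ord0 ord0).

Lemma sg_nat a : sg a = (a == 0)%:R - (a != 0)%:R.
Proof. by case: (F2P a) => ->. Qed.

Lemma card_setsum (T : finType) (P : pred T) : #|[set o | P o]| = (\sum_o P o)%N.
Proof.
by rewrite -sum1_card big_mkcond; apply: eq_bigr => o _; rewrite inE; case: (P o).
Qed.

(** The bias is the difference of the two counts and [#|Om|] their sum; nonnegativity makes 0 the
    more likely value, with probability at most [(1 + 2 ^- t) / 2]. *)
Lemma bias_card L (Om : finType) (g : Om -> 'cV['F_2]_L) y t :
  0 <= bias g y -> (2 ^ t)%:R * bias g y <= #|Om|%:R ->
  forall b, (2 ^ t.+1 * #|[set o | ((y *m g o) ord0 ord0 != 0%R) == b]|
             <= (2 ^ t).+1 * #|Om|)%N.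
Proof.
set Z := fun b => #|[set o | ((y *m g o) ord0 ord0 != 0%R) == b]|.
have eq_bias : bias g y = (Z false)%:R - (Z true)%:R.
  rewrite /Z !card_setsum !natr_sum /bias -sumrB; apply: eq_bigr => o _.
  by rewrite sg_nat; case: eqP.
have eq_card : #|Om| = (Z false + Z true)%N.
  rewrite /Z !card_setsum -big_split /= -sum1_card; apply: eq_bigr => o _.
  by case: (_ ord0 ord0 == 0%R).
rewrite eq_bias eq_card -/(Z _) expnS => ge0 le b; rewrite -/(Z b).
have : (Z b <= Z false)%N by case: b; lia.
have := expn_gt0 2 t; rewrite /=; set p := (2 ^ t)%N in le *; nia.
Qed.

Lemma bernoulli a w r : (a ^ r.+1 + r.+1 * w * a ^ r <= (a + w) ^ r.+1)%N.
Proof.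
elim: r => [|r IH]; first by rewrite !expn1 expn0; lia.
rewrite (expnS (a + w)%N); apply: leq_trans (leq_mul (leqnn _) IH).
rewrite !(expnS a); move: (a ^ r)%N => p; nia.
Qed.

(** This is [(1 - w / L) ^ r <= 1 / 2], from Bernoulli's inequality: at density at least [1 / r],
    [r] picks halve the bias. *)
Lemma double_exp_le L w r : (0 < r)%N -> (L <= r * w)%N -> (2 * (L - w) ^ r <= L ^ r)%N.
Proof.
case: r => // r _ le_L; have [le_w|lt_w] := leqP L w.
  have -> : (L - w = 0)%N by lia.
  by rewrite exp0n.
have := bernoulli (L - w) w r; have -> : (L - w + w = L)%N by lia.
apply: leq_trans; rewrite mul2n -addnn leq_add2l expnS leq_mul2r; lia.
Qed.

(* Each of the k picks is void with probability 1/2, which makes the bias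
   nonnegative. *)
Lemma lazy_sampler L k :
  exists (Om : finType) (g : Om -> 'cV['F_2]_L), 
  [/\ #|Om| = ((2 * L) ^ k)%N, forall o, (nnz (g o) <= k)%N
    & forall y, bias g y = ((2 * (L - wt y)) ^ k)%:R].
Proof.
pose h (y : 'rV['F_2]_L) (p : bool * 'I_L) : 'F_2 := if p.1 then y ord0 p.2 else 0.
exists {ffun 'I_k -> bool * 'I_L},
  (fun phi : {ffun _} => \col_j \sum_(i < k) ((phi i).1 && ((phi i).2 == j))%:R); split.
- by rewrite card_ffun card_prod card_bool !card_ord.
- move=> phi; apply: (@leq_trans (\sum_(j < L) \sum_(i < k) ((phi i).2 == j))).
    apply: leq_sum => j _; rewrite (big_ord1 addn (fun j' : 'I_1 => _)) mxE.
    have [i ij|no_i] := pickP (fun i => (phi i).2 == j).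
      by rewrite [X in (_ <= X)%N](bigD1 i) //= ij; apply: leq_trans (leq_b1 _) _.
    by rewrite big1 ?eqxx // => i _; rewrite no_i andbF.
  rewrite exchange_big /= -[X in (_ <= X)%N](card_ord k) -sum1_card.
  apply: leq_sum => i _; rewrite (bigD1 (phi i).2) //= eqxx big1 // => j.
  by rewrite eq_sym => /negbTE->.
(* The picks are independent, so the bias is the [k]-th power of the sign sum of one pick:
   [L - 2 * wt y] from nonvoid choices plus [L] from void ones. *)
move=> y; transitivity (\sum_(phi : {ffun 'I_k -> bool * 'I_L}) \prod_(i < k) sg (h y (phi i))).
  apply: eq_bigr => phi _; rewrite -sg_sum; congr sg.
  rewrite mxE; under eq_bigr => j _ do rewrite mxE big_distrr.
  rewrite exchange_big; apply: eq_bigr => i _ /=.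
  rewrite /h; case: (phi i) => -[] p /=; last by rewrite big1 // => j _; rewrite mulr0.
  rewrite (bigD1 p) //= eqxx mulr1 big1 ?addr0 // => j.
  by rewrite eq_sym => /negbTE->; rewrite mulr0.
rewrite -(bigA_distr_bigA (fun=> sg \o h y)) /= prodr_const card_ord natrX; congr (_ ^+ k).
have le_wt : (wt y <= L)%N.
  by rewrite /wt -[X in (_ <= X)%N](card_ord L) -sum1_card; apply: leq_sum => j _; case: eqP.
have -> : \sum_p sg (h y p) = \sum_j sg (y ord0 j) + \sum_(j < L) sg 0.
  by rewrite -[RHS](big_bool _ (fun b => \sum_j sg (h y (b, j)))) pair_bigA; apply: eq_bigr => -[].
have -> : \sum_(j < L) sg 0 = L%:R by rewrite sumr_const card_ord.
have -> : \sum_j sg (y ord0 j) = L%:R - (wt y)%:R *+ 2.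
  rewrite -[in L%:R](card_ord L) -sumr_const natr_sum -sumrMnl -sumrB.
  by apply: eq_bigr => j _; rewrite sg_nat; case: eqP.
rewrite natrM natrB //; ring.
Qed.

(* X is the set of messages on which a random output bit has bias at most 2^-t.
   The bias must be nonnegative on all messages: under concatenation biases
   multiply, so one good block is then enough. *)
Definition samp n d s k t (X : {set 'rV['F_2]_n}) : Prop :=
  exists L (M : 'M['F_2]_(n, L)) (Om : finType) (g : Om -> 'cV['F_2]_L),
  [/\ circ d s M, (0 < #|Om|)%N, forall o, (nnz (g o) <= k)%N,
      forall x, 0 <= bias g (x *m M)
    & forall x, x \in X -> (2 ^ t)%:R * bias g (x *m M) <= #|Om|%:R].

Lemma bias_le L (Om : finType) (g : Om -> 'cV['F_2]_L) y : bias g y <= #|Om|%:R.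
Proof.
rewrite -sumr_const; apply: ler_sum => o _; rewrite /sg; by case: (_ != _).
Qed.

Lemma samp_mono n d s k t X d' s' k' (X' : {set 'rV['F_2]_n}) :
  samp d s k t X -> (d <= d')%N -> (s <= s')%N -> (k <= k')%N -> X' \subset X ->
  samp d' s' k' t X'.
Proof.
move=> [L [M [Om [g [cM Om_gt0 nnz_g ge0 le]]]]] led les lek /subsetP sX.
exists L, M, Om, g; split=> //.
- exact: circ_mono cM.
- by move=> o; apply: leq_trans (nnz_g o) lek.
- by move=> x /sX; apply: le.
Qed.

Lemma samp_set0 n d t : (0 < d)%N -> samp d 0 0 t (set0 : {set 'rV['F_2]_n}).
Proof.
move=> d_gt0; exists 0%N, 0, unit, (fun=> 0); split=> //.
- by apply: circ_mono (circ_layer _) => //; rewrite nnz0.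
- by rewrite card_unit.
- by move=> o; rewrite nnz0.
- by move=> x; apply: sumr_ge0 => o _; rewrite mulmx0 mxE.
- by move=> x; rewrite inE.
Qed.

Lemma samp_setU n d s1 k1 s2 k2 t (X1 X2 : {set 'rV['F_2]_n}) :
  samp d s1 k1 t X1 -> samp d s2 k2 t X2 ->
  samp d (s1 + s2) (k1 + k2) t (X1 :|: X2).
Proof.
move=> [L1 [M1 [Om1 [g1 [c1 Om1_gt0 nnz1 ge1 le1]]]]].
move=> [L2 [M2 [Om2 [g2 [c2 Om2_gt0 nnz2 ge2 le2]]]]].
pose g (o : Om1 * Om2) := col_mx (g1 o.1) (g2 o.2).
have biasM x : bias g (x *m row_mx M1 M2) = bias g1 (x *m M1) * bias g2 (x *m M2).
  rewrite /bias big_distrlr /= pair_bigA; apply: eq_bigr => -[o1 o2] _ /=.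
  by rewrite mul_mx_row mul_row_col mxE sgD.
exists (L1 + L2)%N, (row_mx M1 M2), (Om1 * Om2)%type, g; split.
- exact: circ_join.
- by rewrite card_prod muln_gt0 Om1_gt0.
- by move=> o; rewrite nnz_col_mx leq_add.
- by move=> x; rewrite biasM mulr_ge0.
move=> x; rewrite biasM card_prod natrM inE => /orP[] xX.
  by rewrite mulrA ler_pM ?mulr_ge0 ?le1 ?bias_le.
by rewrite mulrCA ler_pM ?mulr_ge0 ?le2 ?bias_le.
Qed.

Lemma density_sampler L r t : (0 < L)%N -> (0 < r)%N ->
  exists (Om : finType) (g : Om -> 'cV['F_2]_L),
  [/\ (0 < #|Om|)%N, forall o, (nnz (g o) <= r * t)%N, forall y, 0 <= bias g y
    & forall y, (L <= r * wt y)%N -> (2 ^ t)%:R * bias g y <= #|Om|%:R].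
Proof.
move=> L_gt0 r_gt0; have [Om [g [cardO nnz_g biasE]]] := lazy_sampler L (r * t).
exists Om, g; split=> //.
- by rewrite cardO expn_gt0 muln_gt0 L_gt0.
- by move=> y; rewrite biasE ler0n.
move=> y le_L; rewrite biasE cardO -natrM ler_nat !expnMn mulnCA leq_mul2l.
rewrite !expnM -expnMn; apply/orP; right; move: (double_exp_le r_gt0 le_L).
by case: (t) => // t'; rewrite leq_exp2r.
Qed.

Lemma samp_of_dense n d s r t L (M : 'M['F_2]_(n, L)) (X : {set 'rV['F_2]_n}) :
  (0 < L)%N -> (0 < r)%N -> circ d s M ->
  (forall x, x \in X -> (L <= r * wt (x *m M))%N) -> samp d s (r * t) t X.
Proof.
move=> L_gt0 r_gt0 cM dense.
have [Om [g [Om_gt0 nnz_g ge0 le]]] := density_sampler t L_gt0 r_gt0.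
by exists L, M, Om, g; split=> // x /dense; apply: le.
Qed.

Lemma wt_card n (x : 'rV['F_2]_n) : wt x = #|[set j | x ord0 j != 0]|.
Proof. by rewrite card_setsum. Qed.

Lemma columns_of_sampler n L (f : 'rV['F_2]_n -> 'rV['F_2]_L) (X : {set 'rV['F_2]_n})
    (Om : finType) (g : Om -> 'cV['F_2]_L) s t m k :
  (0 < #|Om|)%N -> (forall o, (nnz (g o) <= s)%N) ->
  (forall x, x \in X -> 0 <= bias g (f x)) ->
  (forall x, x \in X -> (2 ^ t)%:R * bias g (f x) <= #|Om|%:R) ->
  (#|X| * #|[set J : {set 'I_m} | #|J| < k]| * (2 ^ t).+1 ^ m < 2 ^ (t.+1 * m))%N ->
  exists A : 'M['F_2]_(L, m),
    (nnz A <= m * s)%N /\ forall x, x \in X -> (k <= wt (f x *m A))%N.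
Proof.
move=> Om_gt0 nnz_g ge0 le lt_X.
have [x b xX|phi phiP] := @exists_columns _ _ X
    (fun x o => (f x *m g o) ord0 ord0 != 0) t m k Om_gt0 _ lt_X.
  by apply: bias_card; [apply: ge0|apply: le].
exists (\matrix_(i, j) g (phi j) i ord0); split.
  rewrite /nnz exchange_big -[X in (X * _)%N](card_ord m) -sum_nat_const.
  apply: leq_sum => j _; apply: leq_trans (nnz_g (phi j)).
  by apply: leq_sum => i _; rewrite big_ord1 mxE.
move=> x xX; apply: leq_trans (phiP x xX) _; rewrite wt_card.
apply/subset_leq_card/subsetP=> j; rewrite !inE !mxE.
by under [in X in _ -> X]eq_bigr => i _ do rewrite mxE.
Qed.

Lemma code_of_samp n d s k t (X : {set 'rV['F_2]_n}) m w : samp d s k t X ->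
  (#|X| * #|[set J : {set 'I_m} | #|J| < w]| * (2 ^ t).+1 ^ m < 2 ^ (t.+1 * m))%N ->
  exists M : 'M['F_2]_(n, m), circ d.+1 (s + m * k.+1) M /\
    forall x, x \in X -> (w <= wt (x *m M))%N.
Proof.
move=> [L [M [Om [g [cM Om_gt0 nnz_g ge0 le]]]]] lt_X.
have [x _|//|A [nnzA wtA]] := columns_of_sampler (f := mulmx^~ M) Om_gt0 nnz_g _ _ lt_X.
  exact: ge0.
exists (M *m A); split; last by move=> x /wtA; rewrite mulmxA.
rewrite -addn1; apply: circ_mono (circ_comp cM (circ_layer A)) => //.
by rewrite leq_add2l mulnS addnC leq_add2l.
Qed.

(** In the expansion of [u.+1 ^ m] as the sum of [u ^ (m - #|J|)] over all [J], every small [J]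
    contributes at least [u ^ (m - w)]. *)
Lemma card_small_sets m w u : (0 < u)%N ->
  (#|[set J : {set 'I_m} | #|J| <= w]| * u ^ (m - w) <= u.+1 ^ m)%N.
Proof.
move=> u_gt0; rewrite -addn1 addnC -[X in (_ <= _ ^ X)%N](card_ord m) -prod_nat_const bigA_distr.
rewrite -sum1_card big_distrl /=.
rewrite [leqRHS](bigID (fun J : {set 'I_m} => #|J| <= w)%N) /=.
apply: leq_trans (leq_addr _ _); rewrite big_mkcond [leqRHS]big_mkcond.
apply: leq_sum => J _; rewrite inE; case: ifP => // leJ; rewrite mul1n.
rewrite (bigID (mem J)) /= big1 => [|j -> //]; rewrite mul1n.
rewrite [leqRHS](eq_bigr (fun=> u)) => [|j /negbTE-> //].
rewrite prod_nat_const.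
have -> : (#|[pred i | i \notin J]| = m - #|J|)%N.
  rewrite -[X in (X - _)%N]card_ord -(cardsC J) addKn.
  by apply: eq_card => i; rewrite !inE.
by rewrite leq_pexp2l // leq_sub2l.
Qed.

(** * Codes of depth one and two *)

(** The count required by [exists_columns] for [2 ^ a] messages, [16 * a] columns and bias at most
    1/2. *)
Lemma vol16 a : (0 < a)%N ->
  (2 ^ a * #|[set J : {set 'I_(16 * a)} | #|J| < a]| * (2 ^ 1).+1 ^ (16 * a)
     < 2 ^ (2 * (16 * a)))%N.
Proof.
move=> a_gt0; rewrite [X in (_ < X)%N]expnM; change (2 ^ 1).+1 with 3%N; change (2 ^ 2)%N with 4%N.
have := @card_small_sets (16 * a) a 16 isT.
set V := #|_|; set V' := #|_|; have le_V : (V' <= V)%N.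
  by apply/subset_leq_card/subsetP=> J; rewrite !inE; apply: ltnW.
have -> : (16 * a - a = 15 * a)%N by lia.
move=> le_vol; rewrite -(@ltn_pmul2r (16 ^ (15 * a))) ?expn_gt0 //.
apply: (@leq_ltn_trans (2 ^ a * 51 ^ (16 * a))); last first.
  (* Taking [a]-th roots leaves [2 * 51 ^ 16 < 4 ^ 16 * 16 ^ 15]. *)
  rewrite !expnM -!expnMn (ltn_exp2r _ _ a_gt0).
  lia.
have -> : (51 ^ (16 * a) = 17 ^ (16 * a) * 3 ^ (16 * a))%N by rewrite -expnMn.
rewrite -!mulnA leq_mul2l; apply/orP; right.
rewrite [(3 ^ _ * _)%N]mulnC mulnA leq_mul2r; apply/orP; right.
by apply: leq_trans le_vol; rewrite leq_mul2r le_V orbT.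
Qed.

Lemma dense_columns n L (f : 'rV['F_2]_n -> 'rV['F_2]_L) (X : {set 'rV['F_2]_n}) r a :
  (0 < L)%N -> (0 < r)%N -> (0 < a)%N -> (#|X| <= 2 ^ a)%N ->
  (forall x, x \in X -> (L <= r * wt (f x))%N) ->
  exists A : 'M['F_2]_(L, 16 * a),
    (nnz A <= 16 * a * r)%N /\ forall x, x \in X -> (a <= wt (f x *m A))%N.
Proof.
move=> L_gt0 r_gt0 a_gt0 leX dense.
have [Om [g [Om_gt0 nnz_g ge0 le]]] := density_sampler 1 L_gt0 r_gt0.
rewrite muln1 in nnz_g.
apply: columns_of_sampler Om_gt0 nnz_g _ (fun x xX => le _ (dense x xX)) _ => //.
apply: leq_ltn_trans (vol16 a_gt0); rewrite leq_mul2r leq_mul2r leX !orbT //.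
Qed.

Lemma code_of_samp16 n d s k (X : {set 'rV['F_2]_n}) a :
  (0 < a)%N -> (#|X| <= 2 ^ a)%N -> samp d s k 1 X ->
  exists M : 'M['F_2]_(n, 16 * a), circ d.+1 (s + 16 * a * k.+1) M /\
    forall x, x \in X -> (a <= wt (x *m M))%N.
Proof.
move=> a_gt0 leX sX; apply: code_of_samp sX _.
apply: leq_ltn_trans (vol16 a_gt0); rewrite leq_mul2r leq_mul2r leX !orbT //.
Qed.

(** Weight [n] out of [16 * n] is demanded only for messages of relative weight at least [1 / r];
    the recursion improves the dependence of the cost on [r]. *)
Definition code d n r s := exists M : 'M['F_2]_(n, 16 * n),
  circ d s M /\ forall x, (n <= r * wt x)%N -> (n <= wt (x *m M))%N.

Lemma card_rV n (X : {set 'rV['F_2]_n}) : (#|X| <= 2 ^ n)%N.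
Proof. by apply: leq_trans (max_card _) _; rewrite card_mx card_Fp // mul1n. Qed.

Lemma code_mono d n r s d' r' s' : (d <= d')%N -> (r' <= r)%N -> (s <= s')%N ->
  code d n r s -> code d' n r' s'.
Proof.
move=> led ler les [M [cM wtM]]; exists M; split; first exact: circ_mono cM.
by move=> x le_n; apply: wtM; apply: leq_trans le_n _; rewrite leq_mul2r ler orbT.
Qed.

Lemma code_of_samp_n d n r s k : (0 < n)%N ->
  samp d s k 1 [set x : 'rV['F_2]_n | n <= r * wt x]%N ->
  code d.+1 n r (s + 16 * n * k.+1).
Proof.
move=> n_gt0 /(code_of_samp16 n_gt0 (card_rV _))[M [cM wtM]].
by exists M; split=> // x le_n; apply: wtM; rewrite inE.
Qed.

Lemma code1 n r : (0 < n)%N -> (0 < r)%N -> code 1 n r (32 * n * r).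
Proof.
move=> n_gt0 r_gt0.
have [x|A [nnzA wtA]] := @dense_columns n n id [set x | n <= r * wt x]%N r n
  n_gt0 r_gt0 n_gt0 (card_rV _).
  by rewrite inE.
exists A; split; last by move=> x le_n; apply: wtA; rewrite inE.
apply: circ_mono (circ_layer A) => //; nia.
Qed.

Lemma samp_bigcup n d s k t b (Z : nat -> {set 'rV['F_2]_n}) : (0 < d)%N ->
  (forall i, (i < b)%N -> samp d s k t (Z i)) ->
  samp d (b * s) (b * k) t (\bigcup_(i < b) Z i).
Proof.
move=> d_gt0; elim: b => [_|b IH sZ]; first by rewrite big_ord0; apply: samp_set0.
rewrite big_ord_recr /= !mulSn addnC [X in samp _ _ X]addnC.
apply: samp_setU; last exact: sZ.
by apply: IH => i lti; apply: sZ; apply: ltnW.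
Qed.

Lemma supp_inj n : injective (fun x : 'rV['F_2]_n => [set j | x ord0 j != 0]).
Proof.
move=> x y /setP eq_xy; apply/rowP=> j; have := eq_xy j; rewrite !inE.
by case: (F2P (x ord0 j)) (F2P (y ord0 j)) => -> [] ->.
Qed.

Lemma card_wt_le n v :
  (#|[set x : 'rV['F_2]_n | wt x <= v]| <= #|[set J : {set 'I_n} | #|J| <= v]|)%N.
Proof.
rewrite -(card_imset _ (@supp_inj n)); apply/subset_leq_card/subsetP=> J.
by case/imsetP=> x; rewrite !inE => le_v ->; rewrite -wt_card.
Qed.

Lemma expSn_le u h : (u.+1 ^ h.+1 <= u ^ h.+1 + h.+1 * u.+1 ^ h)%N.
Proof.
elim: h => [|h IH]; first by rewrite !expn1 expn0; lia.
rewrite (expnS u.+1 h.+1) (expnS u h.+1).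
have := expnS u.+1 h; move: (u.+1 ^ h.+1)%N (u.+1 ^ h)%N (u ^ h.+1)%N IH => B C A le BE.
have : (u * B <= u * A + u * (h.+1 * C))%N by rewrite -mulnDr leq_mul2l le orbT.
have : (u * (h.+1 * C) <= h.+1 * B)%N by rewrite BE; nia.
lia.
Qed.

(** Apply [card_small_sets] at [u = 2 ^ i.+1 - 1], for which [(1 + 1 / u) ^ (2 ^ i) <= 2] and hence
    [(1 + 1 / u) ^ n <= 2 ^ v.+1]. *)
Lemma card_light n v i : (2 ^ i * v <= n < 2 ^ i * v.+1)%N ->
  (#|[set x : 'rV['F_2]_n | wt x <= v]| <= 2 ^ ((i + 2) * v.+1))%N.
Proof.
case/andP=> le_n lt_n; apply: leq_trans (card_wt_le _ _) _.
set h := (2 ^ i)%N in le_n lt_n; have h_gt0 : (0 < h)%N by rewrite expn_gt0.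
pose u := (h + h).-1; have uE : u.+1 = (h + h)%N by rewrite /u; lia.
have u_gt0 : (0 < u)%N by lia.
have := card_small_sets n v u_gt0; set V := #|_| => le_V.
have le2 : (u.+1 ^ h <= 2 * u ^ h)%N.
  have := expSn_le u h.-1; rewrite prednK // => le.
  have eq : (u.+1 ^ h = u.+1 * u.+1 ^ h.-1)%N by rewrite -expnS prednK.
  have : (2 * (h * u.+1 ^ h.-1) = u.+1 ^ h)%N by rewrite eq {2}uE addnn -mul2n mulnA.
  lia.
have le_n2 : (u.+1 ^ n <= 2 ^ v.+1 * u ^ n)%N.
  pose e := (h * v.+1 - n)%N; have eE : (n + e = h * v.+1)%N by rewrite /e; lia.
  rewrite -(@leq_pmul2r (u.+1 ^ e)) ?expn_gt0 // -expnD eE expnM.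
  apply: (@leq_trans ((2 * u ^ h) ^ v.+1)); first by rewrite leq_exp2r.
  rewrite expnMn -expnM -eE expnD -mulnA leq_mul2l leq_mul2l; apply/orP; right.
  by apply/orP; right; case: (e) => // e'; rewrite leq_exp2r.
have le_vn : (v <= n)%N by nia.
have : (V <= 2 ^ v.+1 * u ^ v)%N.
  rewrite -(@leq_pmul2r (u ^ (n - v))) ?expn_gt0 ?u_gt0 //.
  by rewrite -mulnA -expnD subnKC //; apply: leq_trans le_V le_n2.
move/leq_trans; apply; apply: (@leq_trans (2 ^ v.+1 * (2 ^ i.+1) ^ v)).
  rewrite leq_mul2l; apply/orP; right; case: (v) => // v'; rewrite leq_exp2r //.
  by rewrite expnS -/h; lia.
by rewrite -expnM -expnD leq_exp2l //; nia.
Qed.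

(** At most [2 ^ a] messages have this weight scale, with [a] of order [(i + 2) * n / 2 ^ i], so
    [16 * a] columns of [2 ^ i.+1] wires suffice. *)
Lemma samp_scale n t i : (0 < n)%N ->
  samp 1 (96 * (i + 2) * n) (16 * t) t
    [set x : 'rV['F_2]_n | 2 ^ i * wt x <= n < 2 ^ i.+1 * wt x]%N.
Proof.
move=> n_gt0; have [lt_n|le_n] := ltnP n (2 ^ i).
  apply: samp_mono (samp_set0 _ _ (ltn0Sn 0)) _ _ _ _ => //.
  by apply/subsetP=> x; rewrite !inE; case: (wt x) => [|w]; [lia|nia].
have h_gt0 : (0 < 2 ^ i)%N by rewrite expn_gt0.
pose v := (n %/ 2 ^ i)%N.
have v_n : (2 ^ i * v <= n < 2 ^ i * v.+1)%N by rewrite /v; nia.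
pose X := [set x : 'rV['F_2]_n | wt x <= v & n <= 2 ^ i.+1 * wt x]%N.
pose a := ((i + 2) * v.+1)%N.
have a_gt0 : (0 < a)%N by rewrite /a; lia.
have leX : (#|X| <= 2 ^ a)%N.
  apply: leq_trans (card_light v_n).
  by apply/subset_leq_card/subsetP=> x; rewrite !inE => /andP[].
have [x|A [nnzA wtA]] := dense_columns (f := id) n_gt0 (expn_gt0 2 i.+1) a_gt0 leX.
  by rewrite inE => /andP[].
apply: samp_mono (@samp_of_dense _ _ _ 16 t _ A X _ _ (circ_layer A) _) _ _ _ _ => //.
- by rewrite muln_gt0.
- by move=> x /wtA; rewrite leq_mul2l.
- rewrite expnS in nnzA; nia.
- apply/subsetP=> x; rewrite !inE => /andP[le1 lt2].
  rewrite (ltnW lt2) andbT /v leq_divRL // mulnC //.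
Qed.

(** One block for each of the [(up_log 2 r).+1] dyadic scales of relative weight, each costing of
    order [n] times that number. *)
Lemma code2 n r : (0 < n)%N -> (0 < r)%N ->
  code 2 n r (464 * n * (up_log 2 r).+1 ^ 2).
Proof.
move=> n_gt0 r_gt0; pose I := (up_log 2 r).+1.
have sI : samp 1 (I * (96 * (I + 1) * n)) (I * 16) 1
    [set x : 'rV['F_2]_n | n <= r * wt x]%N.
  pose Z i := [set x : 'rV['F_2]_n | 2 ^ i * wt x <= n < 2 ^ i.+1 * wt x]%N.
  apply: (@samp_mono _ 1 _ _ _ (\bigcup_(i < I) Z i)) (leqnn _) (leqnn _) (leqnn _) _.
    apply: samp_bigcup => // i ltI; rewrite -[16%N]muln1.
    apply: samp_mono (samp_scale 1 i n_gt0) _ _ _ _ => //; nia.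
  apply/subsetP=> x; rewrite inE => le_n.
  have wx_gt0 : (0 < wt x)%N by case: (wt x) le_n => //; lia.
  have le_r : (n %/ wt x <= r)%N.
    by rewrite -(mulnK r wx_gt0); apply: leq_div2r.
  have wx_le : (wt x <= n)%N by rewrite wt_card -[X in (_ <= X)%N]card_ord max_card.
  have q_gt0 : (0 < n %/ wt x)%N by rewrite divn_gt0.
  pose i := trunc_log 2 (n %/ wt x).
  have le_i : (2 ^ i <= n %/ wt x)%N by apply: trunc_logP.
  have lt_i : (n %/ wt x < 2 ^ i.+1)%N by apply: trunc_log_ltn.
  have lt_I : (i < I)%N.
    rewrite ltnS -(@leq_exp2l 2) //; apply: leq_trans (leq_trans le_i le_r) _.
    exact: up_logP.
  apply/bigcupP; exists (Ordinal lt_I) => //; rewrite inE.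
  by rewrite -leq_divRL // le_i -ltn_divLR.
apply: code_mono (code_of_samp_n n_gt0 sI) => //.
rewrite -/I; have : (0 < I)%N by []. nia.
Qed.

(** * Condensers *)

Lemma superset_card (T : finType) (A : {set T}) a : (#|A| <= a <= #|T|)%N ->
  exists2 B : {set T}, A \subset B & #|B| = a.
Proof.
elim: a => [|a IH] /andP[leA leT].
  by exists A => //; apply/eqP; rewrite -leqn0.
move: leA; rewrite leq_eqVlt => /predU1P[<-|ltA]; first by exists A.
have [|B sAB cardB] := IH; first by rewrite -ltnS ltA ltnW.
have /set0Pn[b] : ~: B != set0.
  by rewrite -card_gt0 cardsCs setCK cardB subn_gt0.
rewrite inE => bB; exists (b |: B); last by rewrite cardsU1 bB cardB.
by apply: subset_trans sAB (subsetUr _ _).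
Qed.

(** * Binomial estimates and the union bound *)

Lemma exp_self_le w : (w ^ w <= 4 ^ w * w`!)%N.
Proof.
have le_bin : ('C(2 * w, w) <= 4 ^ w)%N.
  have := expnDn 1 1 (2 * w); rewrite -[4%N]/(2 ^ 2)%N -expnM => ->.
  have lt_w : (w < (2 * w).+1)%N by lia.
  by rewrite (bigD1 (Ordinal lt_w)) //= !exp1n !muln1 leq_addr.
apply: leq_trans (leq_mul le_bin (leqnn _)); rewrite bin_ffact.
have : forall k m, (m <= k)%N -> ((k - m).+1 ^ m <= k ^_ m)%N.
  move=> k; elim=> // m IH lt_m; rewrite ffactnSr expnS mulnC leq_mul //; last lia.
  apply: leq_trans (IH (ltnW lt_m)); case: (m) => // m'; rewrite leq_exp2r //; lia.
move/(_ (2 * w)%N w); have -> : (2 * w - w = w)%N by lia.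
move=> le; apply: leq_trans (le _); last by lia.
by case: (w) => // w'; rewrite leq_exp2r.
Qed.

Lemma bin_exp_le n w : ('C(n, w) * w ^ w <= (4 * n) ^ w)%N.
Proof.
apply: leq_trans (leq_mul (leqnn _) (exp_self_le w)) _.
rewrite mulnCA bin_ffact expnMn leq_mul2l; apply/orP; right.
elim: w => // w IH; rewrite ffactnSr expnSr leq_mul // leq_subr //.
Qed.

Lemma geom_sum_lt n (f : nat -> nat) T : (0 < T)%N ->
  (forall w, 2 ^ w.+1 * f w <= T)%N -> (\sum_(w < n) f w < T)%N.
Proof.
move=> T_gt0 le_T; suff : (2 ^ n * \sum_(w < n) f w + T <= 2 ^ n * T)%N.
  by have := expn_gt0 2 n; rewrite /=; nia.
elim: n => [|n IH]; first by rewrite big_ord0 muln0 expn0 mul1n.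
rewrite big_ord_recr /= mulnDr.
have := le_T n; move: IH; rewrite !expnS.
move: (\sum_(i < n) f i)%N (f n) (2 ^ n)%N => s u p; nia.
Qed.

(** The factor [4 ^ 12] comes from bounding ['C(N, 12 * w)], [12 ^ 4] from [(12 * w) ^ (4 * w)], and
    8 from bounding ['C(n, w)] and from the factor [2 ^ w] needed for a geometric sum. *)
Definition q0 : nat := (8 * 4 ^ 12 * 12 ^ 4)%N.

Lemma q0_ge12 : (12 <= q0)%N.
Proof. by rewrite -[X in (X <= _)%N]mul1n leq_mul. Qed.

(** This bounds by [2 ^- w] the probability that all [16 * w] picks of some [w] inputs fall into
    some [12 * w] positions. *)
Lemma expander_term q n N w : (q0 <= q)%N -> (0 < w)%N ->
  (q * w <= N)%N -> (w <= n)%N -> (n <= N * q ^ 2)%N ->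
  (2 ^ w * ('C(n, w) * 'C(N, 12 * w) *
     ((12 * w) ^ (16 * w) * N ^ (16 * (n - w)))) <= N ^ (16 * n))%N.
Proof.
have [P PE] : exists P, P = (4 ^ 12)%N by exists (4 ^ 12)%N.
have [D DE] : exists D, D = (12 ^ 4)%N by exists (12 ^ 4)%N.
rewrite /q0 -PE -DE => le_q w_gt0 le_N le_wn le_n.
have D_ge : (12 <= D)%N by rewrite DE -[X in (X <= _)%N]expn1 leq_exp2l.
have P_gt0 : (0 < P)%N by rewrite PE expn_gt0.
have N_gt0 : (0 < N)%N by nia.
(* What remains, per factor of the [w]-th power, once the denominators of the two binomial bounds
   are cancelled. *)
have key : (2 * P * D * w ^ 3 * (4 * n) <= N ^ 4)%N.
  have le1 : (n * w ^ 2 <= N ^ 3)%N.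
    apply: (@leq_trans (N * q ^ 2 * w ^ 2)); first by rewrite leq_mul2r le_n orbT.
    by rewrite -mulnA -expnMn (expnS N 2) leq_mul2l leq_exp2r // le_N orbT.
  apply: (@leq_trans ((n * w ^ 2) * (8 * P * D * w))).
    by apply: eq_leq; ring.
  rewrite (expnSr N 3) leq_mul // (leq_trans _ le_N) // leq_mul2r le_q orbT //.
have E1 : (N ^ (16 * n) = N ^ (16 * (n - w)) * (N ^ (12 * w) * (N ^ 4) ^ w))%N.
  by rewrite -expnM -!expnD; congr (N ^ _)%N; lia.
have E2 : ((12 * w) ^ (16 * w) = (12 * w) ^ (12 * w) * (D ^ w * (w ^ 3) ^ w * w ^ w))%N.
  have -> : (D ^ w * (w ^ 3) ^ w * w ^ w = ((12 * w) ^ 4) ^ w)%N.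
    by rewrite -!expnMn DE (expnMn 12 w 4) (expnSr w 3) mulnA.
  by rewrite -expnM -expnD; congr (_ ^ _)%N; lia.
have le1 := bin_exp_le N (12 * w); have le2 := bin_exp_le n w.
have E3 : ((4 * N) ^ (12 * w) = P ^ w * N ^ (12 * w))%N.
  by rewrite expnMn PE -expnM.
rewrite E1 E2; rewrite E3 in le1.
apply: (@leq_trans (N ^ (16 * (n - w)) * (2 ^ w * (D ^ w * (w ^ 3) ^ w) *
   (('C(N, 12 * w) * (12 * w) ^ (12 * w)) * ('C(n, w) * w ^ w))))).
  by apply: eq_leq; ring.
rewrite leq_mul2l; apply/orP; right.
apply: leq_trans (leq_mul (leqnn _) (leq_mul le1 le2)) _.
apply: (@leq_trans (N ^ (12 * w) * (2 * P * D * w ^ 3 * (4 * n)) ^ w)).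
  by apply: eq_leq; rewrite !expnMn; ring.
by rewrite leq_mul2l leq_exp2r // key orbT.
Qed.

Lemma natF2_neq0 k : ((k%:R : 'F_2) != 0) = odd k.
Proof.
elim: k => [|k IH]; first by rewrite eqxx.
rewrite -natr1 /= -IH; by case: (F2P k%:R) => ->.
Qed.

Lemma big_fst (V : Type) (idx : V) (op : Monoid.com_law idx) (I J : finType)
    (P : pred I) (F : I * J -> V) :
  \big[op/idx]_(p | P p.1) F p = \big[op/idx]_(i | P i) \big[op/idx]_k F (i, k).
Proof.
rewrite (pair_big_dep P (fun _ _ => true) (fun i k => F (i, k))) /=.
by apply: eq_big => -[i k] //=; rewrite andbT.
Qed.

(** Adjacency matrix modulo 2 of the bipartite multigraph of picks: a position picked an even number
    of times by one input gets no wire from it. *)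
Definition pick_mx n N c (phi : 'I_n * 'I_c -> 'I_N) : 'M['F_2]_(n, N) :=
  \matrix_(i, j) (\sum_(k < c) (phi (i, k) == j))%N%:R.

(* A position hit exactly once gets a 1, and the other hit positions absorb at least
   two of the c * wt x picks each. *)
Lemma picks_wt n N c (phi : 'I_n * 'I_c -> 'I_N) (x : 'rV['F_2]_n) :
  (2 * #|[set phi p | p in [set p | x ord0 p.1 != 0%R]]| <= wt (x *m pick_mx phi) + c * wt x)%N.
Proof.
pose cnt j := (\sum_(p | x ord0 p.1 != 0%R) (phi p == j))%N.
have xA j : (x *m pick_mx phi) ord0 j = (cnt j)%:R.
  rewrite mxE /cnt natr_sum (big_fst _ (fun i => x ord0 i != 0)) [RHS]big_mkcond.
  apply: eq_bigr => i _; rewrite mxE natr_sum.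
  case: (F2P (x ord0 i)) => ->; first by rewrite eqxx mul0r.
  by rewrite oner_neq0 mul1r.
have -> : (c * wt x = \sum_j cnt j)%N.
  rewrite exchange_big /= (eq_bigr (fun=> 1%N)) => [|p _]; last first.
    by rewrite (bigD1 (phi p)) //= eqxx big1 // => j; rewrite eq_sym => /negbTE->.
  rewrite (big_fst _ (fun i => x ord0 i != 0)) /=.
  rewrite big_mkcond /wt big_distrr /=; apply: eq_bigr => i _.
  by case: (_ != 0); rewrite ?muln0 // sum1_card card_ord muln1.
rewrite -sum1_card big_distrr /= big_mkcond /wt -big_split /=.
apply: leq_sum => j _; rewrite xA natF2_neq0; case: imsetP => // -[p].
rewrite inE => xp ->; rewrite muln1.
have : (0 < cnt (phi p))%N by rewrite /cnt (bigD1 p) //= eqxx.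
by move: (cnt _) => k k_gt0; lia.
Qed.

(* With high probability the 16 wt x picks of every light x hit more than 12 wt x
   positions, by a union bound over the supports of x and the sets of 12 wt x
   positions. *)
Lemma condenser q n : (q0 <= q)%N -> (0 < n)%N ->
  exists A : 'M['F_2]_(n, (n %/ q ^ 2).+1),
    (nnz A <= 16 * n)%N /\ forall x, (q ^ 3 * wt x <= n)%N -> (wt x <= wt (x *m A))%N.
Proof.
move=> le_q n_gt0; set N := (n %/ q ^ 2).+1.
have q_ge12 := leq_trans q0_ge12 le_q.
have le_n : (n <= N * q ^ 2)%N.
  by rewrite /N; apply/ltnW/ltn_ceil; rewrite expn_gt0; lia.
have le_w w : (q ^ 3 * w <= n)%N -> (q * w <= N)%N.
  move=> le; rewrite -(@leq_pmul2r (q ^ 2)) ?expn_gt0; last by lia.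
  by apply: leq_trans le_n; apply: leq_trans le; apply: eq_leq; ring.
(* The first component is the weight minus one; the others are a support and a set that may contain
   all its picks. *)
pose I := ('I_n * ({set 'I_n} * {set 'I_N}))%type.
pose P (s : I) := [&& #|s.2.1| == s.1.+1, (q ^ 3 * s.1.+1 <= n)%N & #|s.2.2| == (12 * s.1.+1)%N].
pose B (s : I) := [set phi : {ffun 'I_n * 'I_16 -> 'I_N} |
  [forall p, (p.1 \in s.2.1) ==> (phi p \in s.2.2)]].
have cardB s : P s ->
    #|B s| = ((12 * s.1.+1) ^ (16 * s.1.+1) * N ^ (16 * (n - s.1.+1)))%N.
  case: s => w [S T] /and3P[/= /eqP cardS _ /eqP cardT].
  transitivity #|family (fun p : 'I_n * 'I_16 => mem (if p.1 \in S then T else setT))|.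
    apply: eq_card => phi; rewrite inE; apply/forallP/familyP => H p.
      by have /implyP := H p; case: ifP => // pS /(_ isT).
    by apply/implyP=> pS; have := H p; rewrite pS.
  rewrite card_family_prod.
  rewrite (big_fst _ predT) /=.
  rewrite (eq_bigr (fun i => if i \in S then ((12 * w.+1) ^ 16)%N else (N ^ 16)%N)); last first.
    by move=> i _; rewrite prod_nat_const card_ord; case: ifP; rewrite ?cardT ?cardsT ?card_ord.
  rewrite (bigID (mem S)) /= (eq_bigr (fun=> ((12 * w.+1) ^ 16)%N)) => [|i -> //].
  rewrite [X in (_ * X)%N](eq_bigr (fun=> (N ^ 16)%N)) => [|i /negbTE-> //].
  rewrite !prod_nat_const cardS -!expnM.
  have -> // : (#|[pred i | i \notin S]| = n - w.+1)%N.
  rewrite -[X in (X - _)%N]card_ord -cardS -(cardsC S) addKn.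
  by apply: eq_card => i; rewrite !inE.
have [|phi phiP] := @union_bound {ffun 'I_n * 'I_16 -> 'I_N} _ P B.
  rewrite card_ffun card_prod !card_ord (eq_bigr _ cardB).
  rewrite -(pair_big_dep predT (fun w p => P (w, p)) (fun (w : 'I_n) (p : {set 'I_n} * {set 'I_N}) =>
     (12 * w.+1) ^ (16 * w.+1) * N ^ (16 * (n - w.+1)))%N) /=.
  pose f w := (if q ^ 3 * w.+1 <= n then 'C(n, w.+1) * 'C(N, 12 * w.+1) *
     ((12 * w.+1) ^ (16 * w.+1) * N ^ (16 * (n - w.+1))) else 0)%N.
  apply: (@leq_ltn_trans (\sum_(w < n) f w)); last first.
    rewrite [X in (_ < N ^ X)%N]mulnC; apply: geom_sum_lt => [|w]; first by rewrite expn_gt0.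
    rewrite /f; case: ifP => [le_wn|_]; last by rewrite muln0.
    apply: (expander_term le_q _ (le_w _ le_wn) _ le_n) => //.
    by apply: leq_trans le_wn; rewrite leq_pmull // expn_gt0; lia.
  apply: leq_sum => w _; rewrite sum_nat_const /f /P /=.
  case: ifP => [le_wn|gt_wn]; last first.
    by rewrite (eq_card0 (A := fun p => _)) // => p; rewrite unfold_in /= andbF.
  rewrite leq_mul2r; apply/orP; right.
  apply: (@leq_trans (#|[set S : {set 'I_n} | #|S| == w.+1]| *
    #|[set T : {set 'I_N} | #|T| == 12 * w.+1]|)%N); last by rewrite !card_draws !card_ord.
  rewrite -cardsX.
  by apply/subset_leq_card/subsetP=> -[S T]; rewrite !inE.
exists (pick_mx phi); split.
  rewrite /nnz mulnC -[X in (X * _)%N]card_ord -sum_nat_const.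
  apply: leq_sum => i _; rewrite -[X in (_ <= X)%N]card_ord -sum1_card.
  apply: (@leq_trans (\sum_(j < N) \sum_(k < 16) (phi (i, k) == j))).
    by apply: leq_sum => j _; rewrite mxE natF2_neq0; case: (\sum_(k < 16) _)%N => // k; case: odd.
  rewrite exchange_big /=; apply: leq_sum => k _.
  by rewrite (bigD1 (phi (i, k))) //= eqxx big1 // => j; rewrite eq_sym => /negbTE->.
move=> x le_x; have [->//|wx_gt0] := posnP (wt x).
have := picks_wt phi x; set U := [set _ | _ in _].
(* More than [12 * wt x] hit positions leave weight above [24 * wt x - 16 * wt x]. *)
have [le_U|] := leqP #|U| (12 * wt x); last by lia.
have wx_lt : ((wt x).-1 < n)%N.
  by rewrite prednK // wt_card -[X in (_ <= X)%N](card_ord n) max_card.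
(* The union bound is over sets of exactly [12 * wt x] positions; they fit because [12 <= q] and
   [q * wt x <= N]. *)
have [|T sUT cardT] := @superset_card _ U (12 * wt x).
  by rewrite le_U card_ord (leq_trans _ (le_w _ le_x)) // leq_mul2r q_ge12 orbT.
have := phiP (Ordinal wx_lt, ([set j | x ord0 j != 0], T)).
rewrite /P /= prednK // cardT -wt_card !eqxx le_x => /(_ isT) /negP[].
rewrite inE; apply/forallP=> p; apply/implyP; rewrite inE => xp.
by apply: (subsetP sUT); apply/imsetP; exists p; rewrite ?inE.
Qed.

(** * Recursion on the depth *)

Section NatScope.
Local Open Scope nat_scope.

(** * Growth of logarithms and of iterated functions *)

Lemma exp_cube c : exists J, forall j, J <= j -> (c * j.+1) ^ 3 <= 2 ^ j.
Proof.
exists (4 * (64 * c ^ 3)) => j le_j; pose k := (j %/ 4).+1.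
have le_k : 64 * c ^ 3 <= k by rewrite /k; move: (64 * c ^ 3) le_j => z; lia.
have lt_j : j.+1 <= 4 * k by rewrite /k; lia.
apply: (@leq_trans ((c * (4 * k)) ^ 3)); first by rewrite leq_exp2r // leq_mul2l lt_j orbT.
apply: (@leq_trans (k ^ 4)).
  rewrite !expnMn (expnS k 3) mulnA [_ * 4 ^ 3]mulnC leq_mul2r; apply/orP; right; exact: le_k.
apply: (@leq_trans ((2 ^ (j %/ 4)) ^ 4)); first by rewrite leq_exp2r // /k ltn_expl.
by rewrite -expnM leq_exp2l //; lia.
Qed.

(** Meant for [m = f r] and [q = a * m.+1]: a second block, started at range [q ^ 3] with [f] at
    most logarithmic, ends at range at most [f r]. *)
Lemma growth a : exists2 s0, 0 < s0 & forall m, s0 < (a * m.+1) ^ 3 ->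
  (a * (up_log 2 ((a * m.+1) ^ 3)).+2) ^ 3 <= m.
Proof.
(* With [j = up_log 2 m.+1] positive, the logarithm plus 2 is at most
   [3 * (a + j) + 2 <= (3 * a + 5) * j]. *)
have [J JP] := exp_cube (a * (3 * a + 5)).
exists ((a * 2 ^ J.+1) ^ 3).+1 => // m lt_m.
have a_gt0 : 0 < a by case: (a) lt_m => //.
have ltJ : 2 ^ J.+1 < m.+1.
  by move: (ltnW lt_m); rewrite ltn_exp2r // ltn_pmul2l.
pose j := up_log 2 m.+1.
have le_j : m.+1 <= 2 ^ j by apply: up_logP.
have lt_J : J.+1 < j by rewrite -(@ltn_exp2l 2) //; apply: leq_trans ltJ le_j.
have j_le : 2 ^ j.-1 <= m.
  by rewrite -ltnS; apply: up_log_gtn => //; apply: leq_ltn_trans ltJ; rewrite expn_gt0.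
apply: leq_trans j_le; apply: leq_trans (JP j.-1 _); last by lia.
rewrite leq_exp2r // -mulnA leq_mul2l; apply/orP; right.
have : up_log 2 ((a * m.+1) ^ 3) <= 3 * (a + j).
  apply: up_log_min => //; rewrite [3 * _]mulnC expnM leq_exp2r // expnD leq_mul //.
  exact/ltnW/ltn_expl.
nia.
Qed.

(** A square root lowers the rounded logarithm by at least one, which settles [d = 3]. For larger
    [d], one application of [lambda (d - 2)] reaches some [m], and at most [m.-1] more are
    needed. *)
Lemma lambda_le_log d : 1 < d -> forall y, lambda d y <= (up_log 2 y).+1.
Proof.
elim/ltn_ind: d => -[|[|[|[|d]]]] // IH _ y.
  suff : star Nat.sqrt y <= up_log 2 y by move=> le; apply: leq_trans le _.
  move: y {IH}; elim/ltn_ind => y IHy; have [le1|gt1] := leqP y 1.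
    apply: leq_trans (star_le_pred y (fun m => @lambda_lt 1 m isT)) _.
    by case: y le1 {IHy} => [|[|]].
  apply: leq_trans (starS y (ltn0Sn 0)) _.
  have /IHy : lambda 1 y < y by apply: lambda_lt.
  rewrite -[star Nat.sqrt]/(lambda 3) => le; apply: leq_ltn_trans le _.
  have le_y := @up_logP 2 y isT; set e := up_log 2 y in le_y *.
  have e_gt0 : 0 < e by rewrite /e up_log_gt0.
  rewrite -(prednK e_gt0) ltnS; apply: up_log_min => //.
  have /= [sq _] := PeanoNat.Nat.sqrt_spec y (PeanoNat.Nat.le_0_l y).
  have {}sq : lambda 1 y * lambda 1 y <= y by apply/ssrnat.leP.
  have [/eqP e1|e_neq1] := boolP (e == 1).
    have := @lambda_lt 1 y isT gt1; rewrite e1 in le_y *; rewrite /=; lia.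
  rewrite leqNgt; apply/negP=> lt_s.
  have : 2 ^ e.-1 * 2 ^ e.-1 < y by apply: leq_trans sq; exact: ltn_mul.
  rewrite ltnNge (leq_trans le_y) // -expnD leq_exp2l //; lia.
apply: leq_trans (starS y (ltn0Sn d.+1)) _.
have le := star_le_pred (lambda d.+2 y) (fun m => @lambda_lt d.+2 m isT).
rewrite -[lambda d.+4]/(star (lambda d.+2)).
rewrite ltnS; apply: leq_trans le _.
by have := IH d.+2 (leqnSn _) isT y; case: (lambda d.+2 y).
Qed.

Lemma star_iter (f : nat -> nat) r : (forall m, 1 < m -> f m < m) -> 1 < r ->
  (star f (f r)).+1 <= star f r.
Proof.
move=> f_lt r_gt1.
have ex m : exists i, iter i f m <= 1.
  by have [i _ le1] := iter_le1 m f_lt; exists i.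
have [] := min_natP (ex r); rewrite -/(star f r).
case: (star f r) => [|i]; first by rewrite /= leqNgt r_gt1.
by rewrite iterSr => le1 _; rewrite ltnS; apply: (proj2 (min_natP (ex (f r)))).
Qed.

(** The condenser shortens the message to [N] bits without losing weight, so it enters the inner
    code with relative weight at least [1 / r']. *)
Lemma range_block d n r r' q s t : q0 <= q -> 0 < n ->
  let N := (n %/ q ^ 2).+1 in
  code d N r' s -> (forall w, 0 < w -> n <= r * w -> q ^ 3 * w <= n -> N <= r' * w) ->
  samp d.+1 (16 * n + N + s) (16 * t) t
    [set x : 'rV['F_2]_n | (n <= r * wt x) && (q ^ 3 * wt x <= n)].
Proof.
move=> le_q n_gt0 N [M [cM wtM]] le_N.
have [A [nnzA wtA]] := condenser le_q n_gt0.
have cAM := circ_comp (circ_layer A) cM.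
apply: samp_mono (@samp_of_dense _ _ _ 16 t _ _ _ _ _ cAM _) _ _ _ _ => //.
- move=> x; rewrite inE => /andP[le_n ge_n].
  have wx_gt0 : 0 < wt x by case: (wt x) le_n => //; lia.
  rewrite leq_mul2l mulmxA; apply: wtM.
  by apply: leq_trans (le_N _ wx_gt0 le_n ge_n) _; rewrite leq_mul2l wtA // orbT.
- by rewrite leq_add2r leq_add2r.
Qed.

Lemma range_block_cost n q : 0 < q -> q ^ 3 <= n ->
  (n %/ q ^ 2).+1 * q ^ 2 <= 2 * n /\ (n %/ q ^ 2).+1 <= 2 * n.
Proof.
move=> q_gt0 le_n; have q2_gt0 : 0 < q ^ 2 by rewrite expn_gt0 q_gt0.
have le2 : q ^ 2 <= n by apply: leq_trans le_n; rewrite (expnS q 2) leq_pmull.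
have le1 := leq_divM n (q ^ 2); have le3 := leq_div n (q ^ 2).
by rewrite mulSn; split; lia.
Qed.

(** * Chains of blocks *)

Section Chain.
Variables (d n t c s0 : nat).
Hypotheses (d_gt0 : 0 < d) (n_gt0 : 0 < n) (s0_gt0 : 0 < s0).

Definition heavy r := [set x : 'rV['F_2]_n | n <= r * wt x].

(** There are [b] blocks of [c * n] wires and a last one, a depth-one code, of [32 * s0 * n] wires;
    each adds [16 * t] wires to a sampled bit. *)
Definition chain r b := samp d ((b * c + 32 * s0) * n) (16 * t * b.+1) t (heavy r).

Lemma chain_mono r b r' b' : r' <= r -> b <= b' -> chain r b -> chain r' b'.
Proof.
move=> ler leb Sr; apply: samp_mono Sr _ _ _ _ => //.
- by rewrite leq_mul2r leq_add2r leq_mul2r leb !orbT.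
- by rewrite leq_mul2l ltnS leb orbT.
- by apply/subsetP=> x; rewrite !inE => /leq_trans; apply; rewrite leq_mul2r ler orbT.
Qed.

Lemma chain_base r : r <= s0 -> chain r 0.
Proof.
move=> le_r; apply: (@chain_mono s0 0) => //.
have [M [cM wtM]] := code1 n_gt0 s0_gt0.
apply: samp_mono (@samp_of_dense _ _ _ 16 t _ M (heavy s0) _ _ cM _) _ _ _ _ => //.
- by rewrite muln_gt0.
- by move=> x; rewrite inE => /wtM; rewrite leq_mul2l.
- by rewrite mul0n add0n mulnAC.
- by rewrite muln1.
Qed.

Lemma chain_step r s b :
  samp d (c * n) (16 * t) t [set x : 'rV['F_2]_n | (n <= r * wt x) && (s * wt x <= n)] ->
  chain s b -> chain r b.+1.
Proof.
move=> blk Ss; apply: samp_mono (samp_setU blk Ss) _ _ _ _ => //.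
- by apply: eq_leq; ring.
- by apply: eq_leq; ring.
- apply/subsetP=> x; rewrite !inE => le_n; rewrite le_n /=.
  by case: leqP => //= /ltnW.
Qed.

(** Each round of [k] blocks uses up one iteration of [f], until the range is at most [s0] or a
    round closes the chain. *)
Lemma chain_star (f : nat -> nat) k : (forall m, 1 < m -> f m < m) ->
  (forall r, s0 < r -> chain r k \/ (forall b, chain (f r) b -> chain r (b + k))) ->
  forall r, chain r (k * (star f r).+1).
Proof.
move=> f_lt chP; elim/ltn_ind=> r IH.
have [le_r|gt_r] := leqP r s0; first by apply: chain_mono (chain_base le_r).
have r_gt1 : 1 < r by lia.
case: (chP r gt_r) => [|step]; first by apply: chain_mono => //; rewrite leq_pmulr.
apply: chain_mono (step _ (IH (f r) (f_lt r r_gt1))) => //.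
by rewrite addnC -mulnS leq_mul2l ltnS star_iter // orbT.
Qed.

End Chain.

(** * From [f] to [star f] with two more layers *)

Section Step.
Variables (d a s0 H : nat) (f : nat -> nat).
Hypotheses (d_gt0 : 0 < d) (a_ge : q0 <= a) (s0_gt0 : 0 < s0).
Hypothesis s0P : forall m, s0 < (a * m.+1) ^ 3 ->
  (a * (up_log 2 ((a * m.+1) ^ 3)).+2) ^ 3 <= m.
Hypotheses (f_lt : forall m, 1 < m -> f m < m).
Hypotheses (f_log : forall m, f m <= (up_log 2 m).+1).
Hypothesis codef : forall n r, 0 < n -> 0 < r ->
  code d n r (a ^ 2 * H * n * (f r).+1 ^ 2).

(** The choice of [q] turns the inner cost [a ^ 2 * H * N * (f r).+1 ^ 2] into
    [H * N * q ^ 2 <= 2 * H * n]. The 18 is 16 for the condenser wires and 2 for its [N] gates. *)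
Lemma step_block n t r q : 0 < n -> 0 < r -> a * (f r).+1 = q ->
  samp d.+1 ((18 + 2 * H) * n) (16 * t) t
    [set x : 'rV['F_2]_n | (n <= r * wt x) && (q ^ 3 * wt x <= n)].
Proof.
move=> n_gt0 r_gt0 qE.
have a_gt0 : 0 < a by apply: leq_trans (leq_trans q0_ge12 a_ge).
have q_gt0 : 0 < q by rewrite -qE muln_gt0 a_gt0.
(* For [n < q ^ 3] only the zero message meets the second bound, and it violates the first. *)
have [lt_n|le_n] := ltnP n (q ^ 3).
  apply: samp_mono (samp_set0 _ _ (ltn0Sn d)) _ _ _ _ => //.
  apply/subsetP=> x; rewrite !inE; case: (wt x) => [|w]; first by lia.
  by rewrite [_ * w.+1]mulnS; lia.
have [le1 le2] := range_block_cost q_gt0 le_n.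
have le_q : q0 <= q.
  by apply: leq_trans a_ge _; rewrite -qE leq_pmulr.
apply: samp_mono (range_block t le_q n_gt0 (codef _ r_gt0) _) _ _ _ _ => //.
- move=> w w_gt0 le_w _; apply: leq_trans le_w.
  apply: ltn_Pdiv => //; rewrite -[1]/(1 ^ 2) ltn_exp2r //.
  exact: leq_trans (leq_trans q0_ge12 le_q).
- rewrite mulnDl -[18]/(16 + 2) mulnDl leq_add //; first by rewrite leq_add2l.
  apply: (@leq_trans (H * ((n %/ q ^ 2).+1 * q ^ 2))).
    by move: (_ %/ _).+1 => N; apply: eq_leq; rewrite -qE expnMn; ring.
  by rewrite [2 * H]mulnC -mulnA leq_mul2l le1 orbT.
Qed.

(* Two blocks replace r by q^3 and then by f r, since f (q^3) is logarithmic in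
   f r. *)
Lemma step_chain n t r : 0 < n ->
  chain d.+1 n t (18 + 2 * H) s0 r (2 * (star f r).+1).
Proof.
move=> n_gt0; apply: chain_star => // {}r gt_r.
have r_gt0 : 0 < r by lia.
pose q := a * (f r).+1; have blk1 := step_block t n_gt0 r_gt0 (erefl q).
have [le_q|gt_q] := leqP (q ^ 3) s0.
  by left; apply: chain_mono (chain_step blk1 (chain_base _ _ _ n_gt0 s0_gt0 le_q)).
right=> b Sb; rewrite addn2.
have q3_gt0 : 0 < q ^ 3 by lia.
pose q' := a * (f (q ^ 3)).+1; have blk2 := step_block t n_gt0 q3_gt0 (erefl q').
apply: (chain_step blk1); apply: (chain_step blk2); apply: chain_mono Sb => //.
apply: leq_trans (s0P gt_q); rewrite leq_exp2r // leq_mul2l !ltnS f_log orbT //.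
Qed.

(** Here [H] reproduces itself: two blocks per round cost [4 * H], and the remaining terms, at most
    [32 * s0 + 820], fit into one more [H], while [5 <= a ^ 2]. *)
Lemma step_code n r : 32 * s0 + 820 <= H -> 0 < n ->
  code d.+2 n r (a ^ 2 * H * n * (star f r).+1).
Proof.
move=> le_H n_gt0; apply: code_mono (code_of_samp_n n_gt0 (step_chain 1 r n_gt0)) => //.
have a2 : 5 <= a ^ 2.
  by apply: (@leq_trans (3 ^ 2)) => //; rewrite leq_exp2r // (leq_trans _ (leq_trans q0_ge12 a_ge)).
move: (a ^ 2) a2 (star f r).+1 (ltn0Sn (star f r)) => A leA s s_gt0.
apply: (@leq_trans (5 * H * n * s)); last by rewrite !leq_mul2r leA !orbT.
apply: (@leq_trans (n * s * (36 + 4 * H + 32 * s0 + 784))); last by nia.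
nia.
Qed.
End Step.

(** * The square-root recursion for odd depths *)

Lemma sqrt_block n t r q : q0 <= q -> 0 < n -> r <= q ^ 4 ->
  samp 2 (146 * n) (16 * t) t
    [set x : 'rV['F_2]_n | (n <= r * wt x) && (q ^ 3 * wt x <= n)].
Proof.
move=> le_q n_gt0 le_r.
have q_gt0 : 0 < q by apply: leq_trans (leq_trans q0_ge12 le_q).
have q2_gt0 : 0 < q ^ 2 by rewrite expn_gt0 q_gt0.
have [lt_n|le_n] := ltnP n (q ^ 3).
  apply: samp_mono (samp_set0 _ _ (ltn0Sn 1)) _ _ _ _ => //.
  apply/subsetP=> x; rewrite !inE; case: (wt x) => [|w]; first by lia.
  by rewrite [_ * w.+1]mulnS; lia.
have [le1 le2] := range_block_cost q_gt0 le_n.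
(* From [n <= q ^ 4 * w] follows [n %/ q ^ 2 <= q ^ 2 * w]; the factor 2 absorbs the successor in
   [N]. *)
have r'_gt0 : 0 < 2 * q ^ 2 by rewrite muln_gt0.
apply: samp_mono (range_block t le_q n_gt0 (code1 (ltn0Sn _) r'_gt0) _) _ _ _ _ => //.
- move=> w w_gt0 le_w _; rewrite mul2n -addnn mulnDl -addn1 leq_add //; last first.
    by rewrite muln_gt0 q2_gt0.
  rewrite -[leqRHS](mulnK _ q2_gt0); apply/leq_div2r/(leq_trans le_w).
  by apply: leq_trans (leq_mul le_r (leqnn w)) _; apply: eq_leq; ring.
- move: (_ %/ _).+1 le1 le2 => N le1 le2; move: (q ^ 2) le1 => Q le1; nia.
Qed.

(** With [q] about [r ^ (1 / 4)] a block takes [r] to about [r ^ (3 / 4)], and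
    [(3 / 4) ^ 3 < 1 / 2]. *)
Lemma sqrt_chain : exists2 s0, 0 < s0 &
  forall n t r, 0 < n -> chain 2 n t 146 s0 r (3 * (star Nat.sqrt r).+1).
Proof.
have [la le_la] : exists la, q0 <= 2 ^ la by exists q0; apply/ltnW/ltn_expl.
(* Large enough to absorb three roundings of the exponent and to keep [q0 <= q] in all three
   blocks. *)
pose J := 4 * la + 100; exists (2 ^ (2 * J + 2)); first by rewrite expn_gt0.
move=> n t r n_gt0; apply: chain_star => //.
- by rewrite expn_gt0.
- by move=> m; apply: (@lambda_lt 1).
move=> {}r gt_r; right=> b.
have /= [sq1 sq2] := PeanoNat.Nat.sqrt_spec r (PeanoNat.Nat.le_0_l r).
move: (Nat.sqrt r) sq1 sq2 => m _ /ssrnat.ltP sq2 Sb.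
have m_gt0 : 0 < m.
  case: m sq2 {Sb} => // r_lt1; move: gt_r; rewrite ltnNge; case: r r_lt1 => //.
pose j := trunc_log 2 m.
have le_j : 2 ^ j <= m by apply: trunc_logP.
have lt_j : m.+1 <= 2 ^ j.+1 by apply: trunc_log_ltn.
have le_r : r <= 2 ^ (2 * j + 2).
  apply: (@leq_trans (m.+1 * m.+1)); first exact: ltnW.
  apply: leq_trans (leq_mul lt_j lt_j) _; rewrite -expnD leq_exp2l //; lia.
have J_le : J < j.
  have : 2 ^ (2 * J + 2) < 2 ^ (2 * j + 2) by apply: leq_trans gt_r le_r.
  rewrite ltn_exp2l //; lia.
have step e r' b' : la <= (e + 3) %/ 4 -> r' <= 2 ^ e ->
    chain 2 n t 146 (2 ^ (2 * J + 2)) (2 ^ (3 * ((e + 3) %/ 4))) b' ->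
    chain 2 n t 146 (2 ^ (2 * J + 2)) r' b'.+1.
  move=> le_e le_r'; rewrite [3 * _]mulnC expnM; apply: chain_step; apply: sqrt_block => //.
    by apply: leq_trans le_la _; rewrite leq_exp2l.
  by apply: leq_trans le_r' _; rewrite -expnM leq_exp2l //; lia.
rewrite addn3; apply: (step (2 * j + 2)) => //; first by rewrite /J in J_le; lia.
apply: (step _ _ _ _ (leqnn _)); first by rewrite /J in J_le; lia.
apply: (step _ _ _ _ (leqnn _)); first by rewrite /J in J_le; lia.
apply: chain_mono Sb => //; apply: leq_trans le_j; rewrite leq_exp2l //.
by rewrite /J in J_le; lia.
Qed.

Lemma code3 : exists K, forall n r, 0 < n -> code 3 n r (K * n * (lambda 3 r).+1).
Proof.
have [s0 s0_gt0 ch] := sqrt_chain; exists (32 * s0 + 1500) => n r n_gt0.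
apply: code_mono (code_of_samp_n n_gt0 (ch n 1 r n_gt0)) => //.
rewrite -[lambda 3]/(star Nat.sqrt).
move: (star Nat.sqrt r).+1 (ltn0Sn (star Nat.sqrt r)) => s s_gt0.
apply: (@leq_trans (n * (s * (32 * s0 + 1500)))); last by apply: eq_leq; ring.
apply: (@leq_trans (n * (3 * s * 146 + 32 * s0 + 16 * (16 * (3 * s + 1) + 1)))).
  by apply: eq_leq; ring.
rewrite leq_mul2l; apply/orP; right; nia.
Qed.

(** This stops one layer short of depth [d]: the last layer is sampled later, for the prescribed
    rate and distance. *)
Lemma samp_lambda : exists K, forall d n r t, 3 <= d -> 0 < n ->
  samp d.-1 (K * n * (lambda d r).+1) (64 * t * (lambda d r).+1) t
    [set x : 'rV['F_2]_n | n <= r * wt x].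
Proof.
have [K3 code3P] := code3; have [s1 s1_gt0 ch] := sqrt_chain.
have [s0 s0_gt0 s0P] := growth q0.
(* One constant for all depths: the threshold of [step_code] plus the costs of depths 3 and 2. *)
pose H := 32 * s0 + 820 + K3 + 464.
have codeP d : 2 <= d -> forall n r, 0 < n -> 0 < r ->
    code d n r (q0 ^ 2 * H * n * (lambda d r).+1 ^ 2).
  have q2_gt0 : 0 < q0 ^ 2 by rewrite expn_gt0 (leq_trans _ q0_ge12).
  elim/ltn_ind: d => -[|[|[|[|d]]]] // IH _ n r n_gt0 r_gt0.
  - apply: code_mono (code2 n_gt0 r_gt0) => //; rewrite leq_mul2r leq_mul2r.
    by rewrite (@leq_trans H) ?leq_pmull ?orbT // /H; lia.
  - apply: code_mono (code3P n r n_gt0) => //; rewrite leq_mul //; last by rewrite leq_pmulr.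
    by rewrite leq_mul2r (@leq_trans H) ?leq_pmull ?orbT // /H; lia.
  have le_H : 32 * s0 + 820 <= H by rewrite /H; lia.
  have := @step_code d.+2 q0 s0 H (lambda d.+2) (ltn0Sn _) (leqnn _) s0_gt0 s0P
    (fun m => @lambda_lt d.+2 m isT) (lambda_le_log (d := d.+2) isT)
    (IH d.+2 (leqnSn _) isT) n r le_H n_gt0.
  by apply: code_mono => //; rewrite leq_mul2l leq_pmulr ?orbT.
exists (2 * (18 + 2 * H) + 32 * s0 + 438 + 32 * s1).
move=> [|[|[|[|d]]]] // n r t _ n_gt0.
  apply: samp_mono (ch n t r n_gt0) _ _ _ _ => //.
    rewrite -[lambda 3]/(star Nat.sqrt).
    move: (star Nat.sqrt r) => s; rewrite [_ * n]mulnC -!mulnA [_ * (n * _)]mulnCA leq_mul2l.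
    apply/orP; right; nia.
  rewrite -[lambda 3]/(star Nat.sqrt); nia.
have := @step_chain d.+2 q0 s0 H (lambda d.+2) (ltn0Sn _) (leqnn _) s0_gt0 s0P
    (fun m => @lambda_lt d.+2 m isT) (lambda_le_log (d := d.+2) isT)
    (codeP d.+2 isT) n t r n_gt0.
rewrite -[lambda d.+4]/(star (lambda d.+2)) => sP.
apply: samp_mono sP _ _ _ _ => //.
  move: (star _ r) => s; rewrite [_ * n]mulnC -!mulnA [_ * (n * _)]mulnCA leq_mul2l.
  apply/orP; right; nia.
nia.
Qed.

End NatScope.

(** * The Gilbert-Varshamov bound *)

(** Put each index into [J] with probability [delta]. As [delta < 1 / 2], every set counted here has
    probability at least [2 ^ (- m * entropy delta)]. *)
Lemma card_small_sets_entropy (R : realType) (delta : R) m k : 0 < delta < 1 / 2 ->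
  (forall i, (i < k)%N -> i%:R <= delta * m%:R) ->
  #|[set J : {set 'I_m} | (#|J| < k)%N]|%:R <= expR (m%:R * (entropy delta * ln 2)).
Proof.
move=> /andP[d_gt0 d_lt] le_k.
have ln2_gt0 : 0 < ln 2 :> R by rewrite ln_gt0 // ltr1n.
have hE : entropy delta * ln 2 = - (delta * ln delta + (1 - delta) * ln (1 - delta)).
  by rewrite /entropy /log2; field; rewrite lt0r_neq0.
have d1_gt0 : 0 < 1 - delta by lra.
have ln_le : ln delta <= ln (1 - delta) by rewrite ler_ln ?posrE //; lra.
have one : 1 = \sum_(J : {set 'I_m}) \prod_i (if i \in J then delta else 1 - delta).
  by rewrite -bigA_distr /= prodr_const addrC subrK expr1n.
set V := [set J | _]; rewrite hE mulrN expRN -div1r ler_pdivlMr ?expR_gt0 //.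
rewrite [leRHS]one (bigID (mem V)) /= -[leLHS]addr0 lerD ?sumr_ge0 //; last first.
  move=> J _; apply: prodr_ge0 => i _; case: ifP; lra.
rewrite mulr_natl -sumr_const; apply: ler_sum => J.
rewrite inE => /le_k le_J.
have -> : \prod_i (if i \in J then delta else 1 - delta) =
    expR (#|J|%:R * ln delta + (m%:R - #|J|%:R) * ln (1 - delta)).
  rewrite (bigID (mem J)) /= (eq_bigr (fun=> delta)) => [|i -> //].
  rewrite [X in _ * X](eq_bigr (fun=> 1 - delta)) => [|i /negbTE-> //].
  rewrite !prodr_const expRD.
  have -> : m%:R - #|J|%:R = #|[pred i | i \notin J]|%:R :> R.
    rewrite -[m in m%:R]card_ord -(cardsC J) natrD addrC addKr.
    by congr _%:R; apply: eq_card => i; rewrite !inE.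
  by rewrite !expRM_natl !lnK ?posrE.
rewrite ler_expR; nra.
Qed.

(** Half of the slack [1 - entropy delta - r] pays for [(1 + 2 ^- t) ^ m <= expR (m * 2 ^- t)], the
    other half for rounding [n / r] to [m]. *)
Lemma gilbert_varshamov_count (R : realType) (r delta : R) (t n m k : nat) :
  0 < r -> 0 < delta < 1 / 2 ->
  2 * (2 ^- t) <= (1 - entropy delta - r) * ln 2 ->
  n%:R < r * m.+1%:R -> 2 * r <= (1 - entropy delta - r) * m%:R ->
  (forall i, (i < k)%N -> i%:R <= delta * m%:R) ->
  (2 ^ n * #|[set J : {set 'I_m} | #|J| < k]| * (2 ^ t).+1 ^ m < 2 ^ (t.+1 * m))%N.
Proof.
move=> r_gt0 delta_in le_t lt_n le_m le_k.
have ln2_gt0 : 0 < ln 2 :> R by rewrite ln_gt0 // ltr1n.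
have two i : 2 ^+ i = expR (i%:R * ln 2) :> R by rewrite expRM_natl lnK ?posrE.
rewrite -(ltr_nat R) !natrM !natrX.
have vol := card_small_sets_entropy delta_in le_k.
have le_t1 : ((2 ^ t).+1%:R : R) <= expR (t%:R * ln 2 + 2 ^- t).
  rewrite expRD -two -natr1 natrX.
  have p_gt0 : 0 < 2 ^+ t :> R by rewrite exprn_gt0.
  apply: (@le_trans _ _ (2 ^+ t * (1 + 2 ^- t))).
    by rewrite mulrDr mulr1 divff // lt0r_neq0.
  by rewrite ler_pM2l // expR_ge1Dx.
apply: (@le_lt_trans _ _ (expR (n%:R * ln 2) * expR (m%:R * (entropy delta * ln 2)) *
    expR (m%:R * (t%:R * ln 2 + 2 ^- t)))).
  rewrite [2%:R ^+ n]two [leRHS]mulrC [leLHS]mulrC ler_pM ?exprn_ge0 ?mulr_ge0 ?expR_ge0 //.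
    by rewrite expRM_natl lerXn2r ?nnegrE ?expR_ge0.
  by rewrite ler_wpM2l ?expR_ge0.
rewrite [ltRHS]two -!expRD ltr_expR natrM -natr1.
have n_lt : n%:R * ln 2 < r * m.+1%:R * ln 2 by rewrite ltr_pM2r.
have m_ge : m%:R * (2 * 2 ^- t) <= m%:R * ((1 - entropy delta - r) * ln 2).
  by rewrite ler_wpM2l.
have r_le : 2 * r * ln 2 <= (1 - entropy delta - r) * m%:R * ln 2 by rewrite ler_pM2r.
rewrite -natr1 in n_lt; lra.
Qed.

(** * Assembly at the prescribed rate and distance *)

Lemma hdist_wt m (u v : 'rV['F_2]_m) : hdist u v = wt (u - v).
Proof.
by rewrite wt_card; apply: eq_card => j; rewrite !inE !mxE subr_eq0.
Qed.

Lemma lambda_gt0 d n : (3 <= d)%N -> (1 < n)%N -> (0 < lambda d n)%N.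
Proof.
case: d => [|[|[|d]]] // _ n_gt1; rewrite -[lambda d.+3]/(star (lambda d.+1)).
have [le1 _] := min_natP (lambda_iter n (ltn0Sn d)).
by rewrite lt0n; apply: contraTneq le1; rewrite /star => ->; rewrite -ltnNge.
Qed.

Theorem theorem1p1 (R : realType) (r delta : R) :
  0 < r < 1 -> 0 < delta < 1 / 2 -> r < 1 - entropy delta ->
  exists N K K' : nat, forall n : nat, (N <= n)%N ->
    (forall d : nat, (3 <= d)%N ->
      exists C : lin_circuit n (Num.truncn (n%:R / r)),
        [/\ (circuit_depth C <= d)%N,
            (circuit_size C <= K * lambda d n * n)%N
          & rel_dist_ge delta (compute C)]) /\
    (exists C : lin_circuit n (Num.truncn (n%:R / r)),
        [/\ (circuit_depth C <= alpha n)%N,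
            (circuit_size C <= K' * n)%N
          & rel_dist_ge delta (compute C)]).
Proof.
move=> /andP[r_gt0 r_lt1] delta_in r_lt.
have [K sampP] := samp_lambda.
have ln2_gt0 : 0 < ln 2 :> R by rewrite ln_gt0 // ltr1n.
set eps := 1 - entropy delta - r; have eps_gt0 : 0 < eps by rewrite /eps; lra.
pose t := Num.bound (2 / (eps * ln 2)).
(* The 65 rules out [alpha n = 2], which would need [n <= 2 ^ 6]; the other term yields
   [m_large]. *)
pose N := (65 + Num.bound (2 * r / eps))%N.
pose rho := Num.bound r^-1.
have t_large : 2 * (2 ^- t) <= eps * ln 2.
  have e_gt0 : 0 < eps * ln 2 by rewrite mulr_gt0.
  rewrite ler_pdivrMr ?exprn_gt0 // mulrC -ler_pdivrMr //.
  apply: (@le_trans _ _ t%:R); first by rewrite /t ltW // archi_boundP // divr_ge0 // ltW.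
  by rewrite -natrX ler_nat ltnW // ltn_expl.
(* Doubling comes from [l.+1 <= 2 * l]; the second term is the last layer, with [m <= rho * n]
   outputs. *)
pose K1 := (2 * K + rho * (128 * t + 1))%N.
exists N, K1, (6 * K1)%N => n le_n; set m := Num.truncn _.
have n_gt0 : (0 < n)%N by apply: leq_trans le_n.
have nr_ge0 : 0 <= n%:R / r by rewrite divr_ge0 // ltW.
have /andP[m_le m_gt] := truncn_itv nr_ge0; rewrite -/m in m_le m_gt.
have n_lt : n%:R < r * m.+1%:R by rewrite mulrC -ltr_pdivrMr.
have m_le_rho : (m <= rho * n)%N.
  rewrite -(ler_nat R) natrM; apply: le_trans m_le _; rewrite mulrC ler_wpM2r //.
  by rewrite /rho ltW // archi_boundP // invr_ge0 ltW.
have m_large : 2 * r <= eps * m%:R.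
  rewrite -ler_pdivrMl // [eps^-1 * _]mulrC.
  apply: (@le_trans _ _ (Num.bound (2 * r / eps))%:R).
    by rewrite ltW // archi_boundP // divr_ge0 ?mulr_ge0 // ltW.
  rewrite ler_nat; apply: (@leq_trans n); first by rewrite (leq_trans _ le_n) // leq_addl.
  rewrite -ltnS -(ltr_nat R); apply: le_lt_trans m_gt.
  by rewrite ler_pdivlMr // ler_piMr // ltW.
pose k := (Num.truncn (delta * m%:R)).+1.
have dm_ge0 : 0 <= delta * m%:R by case/andP: delta_in => /ltW d_ge0 _; rewrite mulr_ge0.
have /andP[k_le k_gt] := truncn_itv dm_ge0.
have small i : (i < k)%N -> i%:R <= delta * m%:R.
  by rewrite ltnS => le_i; apply: le_trans k_le; rewrite ler_nat.
have count := gilbert_varshamov_count r_gt0 delta_in t_large n_lt m_large small.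
have main d : (3 <= d)%N -> exists C : lin_circuit n m,
    [/\ (circuit_depth C <= d)%N, (circuit_size C <= K1 * lambda d n * n)%N
      & rel_dist_ge delta (compute C)].
  move=> d_ge3.
  (* At range [n] every nonzero message is covered. *)
  have count' : (#|[set x : 'rV['F_2]_n | (n <= n * wt x)%N]| *
     #|[set J : {set 'I_m} | #|J| < k]| * (2 ^ t).+1 ^ m < 2 ^ (t.+1 * m))%N.
    by apply: leq_ltn_trans count; rewrite !leq_mul2r card_rV !orbT.
  have [M [cM wtM]] := code_of_samp (sampP d n n t d_ge3 n_gt0) count'.
  have [C [depthC sizeC distC]] := circ_lin_circuit n_gt0 cM.
  exists C; split.
  - by apply: leq_trans depthC _; rewrite prednK // (leq_trans _ d_ge3).
  - apply: leq_trans sizeC _.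
    have n_gt1 : (1 < n)%N by apply: leq_trans le_n.
    have l_gt0 := lambda_gt0 d_ge3 n_gt1.
    move: (lambda d n) l_gt0 => l l_gt0.
    have le2l : (l.+1 <= 2 * l)%N by rewrite mul2n -addnn -add1n leq_add2r.
    apply: (@leq_trans (K * n * (2 * l) + rho * n * (64 * t * (2 * l) + l))).
      apply: leq_add; first by rewrite leq_mul2l le2l orbT.
      apply: leq_mul => //; rewrite -addn1 leq_add // leq_mul2l le2l orbT //.
    by apply: eq_leq; rewrite /K1; ring.
  - move=> x y xy; apply: le_trans (ltW k_gt) _; rewrite ler_nat.
    apply: leq_trans (distC x y); rewrite hdist_wt -mulmxBl; apply: wtM.
    rewrite inE leq_pmulr // lt0n; apply: contra_neq xy => wt0.
    apply/eqP; rewrite -subr_eq0; apply/eqP/rowP=> j; rewrite [RHS]mxE.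
    apply/eqP; apply: contraTT (leqnn 0) => xj.
    by move: wt0; rewrite /wt (bigD1 j) //= xj.
split=> //; have [a_gt0 a_even a_le6 _] := alphaP n.
have a_ge3 : (3 <= alpha n)%N.
  move: a_gt0 a_even a_le6; case: (alpha n) => [|[|[|a]]] // _ _ le6.
  have : (n <= 2 ^ 6)%N.
    by apply: leq_trans (up_logP n (isT : 1 < 2)%N) _; rewrite leq_exp2l.
  by rewrite leqNgt (leq_trans _ le_n) // leq_addr.
have [C [depthC sizeC distC]] := main _ a_ge3; exists C; split=> //.
by apply: leq_trans sizeC _; rewrite leq_mul2r [(6 * _)%N]mulnC leq_mul2l a_le6 !orbT.
Qed.
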